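(* Assume that the following two conditions hold. (A1) There exist an integer $m\ge 1$ and $r\in(0,1)$ such that for all $(u,x,y)\in[0,1]\times E^2$, $\|\delta_xQ_u^m-\delta_yQ_u^m\|_{TV}\le r$. (A2) There exist $L>0$ and $\kappa\in(0,1)$ such that for all $(u,v,x)\in[0,1]^2\times E$, $\|\delta_xQ_u-\delta_xQ_v\|_{TV}\le L|u-v|^{\kappa}$. Then for all $u\in[0,1]$ the Markov kernel $Q_u$ has a single invariant probability $\pi_u$, and the triangular array of Markov chains $\{X_{n,k}: n\ge 1, k\le n\}$ is locally stationary. Moreover, there exists a real number $C>0$, only depending on $L,m,r,\kappa$, such that for all $u\in[0,1]$, all integers $n\ge1$, $j\ge 1$ and all integers $k$ with $k+j-1\le n$, $$\|\pi^{(n)}_{k,j}-\pi_{u,j}\|_{TV}\le C\left[\sum_{s=k}^{k+j-1}\left|u-\frac{s}{n}\right|^{\kappa}+\frac{1}{n^{\kappa}}\right].$$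
   Context: $(E,d)$ is a metric space with Borel $\sigma$-field $\mathcal{B}(E)$, and $\mathcal{P}(E^j)$ is the set of probability measures on $E^j$. $\{Q_u:u\in[0,1]\}$ is a family of Markov kernels on $(E,\mathcal{B}(E))$; by convention $Q_u=Q_0$ for $u<0$ (so all objects attached to $Q_u$, $u<0$, are those attached to $Q_0$). For each integer $n\ge1$, $(X_{n,k})_{k\in\mathbb{Z},k\le n}$ is a non-homogeneous Markov chain with $\mathbb{P}(X_{n,k}\in A\mid X_{n,k-1}=x)=Q_{k/n}(x,A)$ for $k\le n$. For $j\ge1$ and $k+j-1\le n$, $\pi^{(n)}_{k,j}$ is the law of $(X_{n,k},\ldots,X_{n,k+j-1})$. When $Q_u$ has a unique invariant probability $\pi_u$, $(X_k(u))_{k\in\mathbb{Z}}$ is a stationary Markov chain with transition kernel $Q_u$ and $\pi_{u,j}$ is the law of $(X_1(u),\ldots,X_j(u))$. For a measure $\mu$ and a kernel $R$, $\mu R(A)=\int R(x,A)\,d\mu(x)$; $\delta_x$ is the Dirac mass at $x$. The total variation distance is $\|\mu-\nu\|_{TV}=\sup_A|\mu(A)-\nu(A)|$, on $\mathcal{P}(E)$ as well as on $\mathcal{P}(E^j)$. Definition (locally stationary). The triangular array $\{X_{n,k}\}$ is locally stationary if for every integer $j\ge1$ there exists a metric $\vartheta_j$ on $\mathcal{P}(E^j)$, metrizing the topology of weak convergence, such that (1) the map $u\mapsto\pi_{u,j}$ is continuous on $[0,1]$; (2) $\lim_{n\to\infty}\sup_{k\le n-j+1}\vartheta_j(\pi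^{(n)}_{k,j},\pi_{k/n,j})=0$.
   Formalization: Local stationarity (only that conclusion) is stated when E is separable or the weak topology on every P(E^j) is metrizable; for arbitrary metric spaces it can fail (discrete E of measurable cardinality, constant kernels), since no metric ϑ_j need exist. *)

(* Defs.v *)
From HB Require Import structures.
From mathcomp Require Import all_boot all_order all_algebra.
From mathcomp Require Import all_classical all_reals all_analysis.

Set Implicit Arguments.
Unset Strict Implicit.
Unset Printing Implicit Defensive.

Import Order.TTheory GRing.Theory Num.Theory.
Import numFieldNormedType.Exports.

Local Open Scope classical_set_scope.
Local Open Scope ring_scope.

HB.mixin Record isBorel (R : realType) (d : measure_display) E
    & Metric R E & Measurable d E := {
  borelE : @measurable d E = <<s @open E >> }.

(* A metric space with its Borel sigma-field. It is nonempty because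
   measurable types are pointed. *)
#[short(type="borelMetricType")]
HB.structure Definition BorelMetric (R : realType) (d : measure_display) :=
  { E of Metric R E & Measurable d E & isBorel R d E }.

Definition separable_space (E : topologicalType) : Prop :=
  exists2 D : set E, countable D & dense D.

(* The library puts the product sigma-field on E^j = j.-tuple E; here it gets
   the product topology. *)
HB.instance Definition _ (T : topologicalType) (j : nat) :=
  Topological.copy (j.-tuple T)
    (initial_topology
       (fun t : j.-tuple T => @tnth j T t : prod_topology (fun _ : 'I_j => T))).

(* Measures of the library are defined on all sets; this is equality as measures. *)
Definition same_measure d (T : measurableType d) (R : realType)
    (mu nu : set T -> \bar R) : Prop :=
  forall A, measurable A -> mu A = nu A.

Definition tv d (T : measurableType d) (R : realType)
    (mu nu : set T -> \bar R) : \bar R :=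
  ereal_sup [set `|mu A - nu A|%E | A in measurable].

Section kernels.
Context d (E : measurableType d) (R : realType).

(* [mact mu K] is the measure written mu K. *)
Definition mact (mu : {measure set E -> \bar R}) (K : E -> set E -> \bar R) :
    set E -> \bar R :=
  fun A => (\int[mu]_x K x A)%E.

Fixpoint kpow (K : R.-pker E ~> E) (m : nat) : E -> set E -> \bar R :=
  if m is m'.+1 then fun x => mact (K x) (kpow K m') else fun x => \d_x.

Definition invariant_measure (K : R.-pker E ~> E) (mu : probability E R) : Prop :=
  same_measure (mact mu (fun x => K x)) mu.

End kernels.

Section chains.
Context dO (O : measurableType dO) d (E : measurableType d) (R : realType).
Variable P : probability O R.

Definition past (X : int -> {RV P >-> E}) (k : int) : set (set O) :=
  <<s [set X l @^-1` A | l in [set l : int | l < k] & A in measurable] >>.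

(* For k in D, K k (X_{k-1}, A) is a version of the conditional probability of
   X_k \in A given the past: it is a measurable function of X_{k-1}, and the
   identity below is the defining property of conditional expectation. *)
Definition markov_chain (D : set int) (K : int -> R.-pker E ~> E)
    (X : int -> {RV P >-> E}) : Prop :=
  forall k, D k -> forall A, measurable A -> forall B, past X k B ->
    P (B `&` X k @^-1` A) = (\int[P]_(w in B) K k (X (k - 1)%R w) A)%E.

Definition block (X : int -> {RV P >-> E}) (k : int) (j : nat) (w : O) :
    j.-tuple E :=
  [tuple X (k + i%:Z) w | i < j].

Lemma measurable_block X k j : measurable_fun [set: O] (block X k j).
Proof.
apply/measurable_fun_tnthP => i.
rewrite (_ : _ \o _ = X (k + i%:Z)); first exact: measurable_funPT.
by apply/funext => w /=; rewrite tnth_mktuple.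
Qed.

HB.instance Definition _ X k j :=
  isMeasurableFun.Build _ _ _ _ (block X k j) (@measurable_block X k j).

Definition law (X : int -> {RV P >-> E}) (k : int) (j : nat) :
    probability (j.-tuple E) R :=
  distribution P (block X k j).

Definition stationary (X : int -> {RV P >-> E}) : Prop :=
  forall (j : nat) (k l : int), same_measure (law X k j) (law X l j).

End chains.

Section weak_convergence.
Context (R : realType) d (E : borelMetricType R d) (j : nat).

(* For separable E, or for j = 1, measurability follows from continuity. *)
Definition test_fun : Type :=
  {f : j.-tuple E -> R | [/\ continuous f, measurable_fun setT f &
                             exists M, forall x, `|f x| <= M]}.

Definition integrals (mu : probability (j.-tuple E) R) :
    prod_topology (fun _ : test_fun => R) :=
  fun f => (\int[mu]_x (sval f x))%R.

(* P(E^j) with the topology of weak convergence. *)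
Definition weak_prob : Type := initial_topology integrals.

HB.instance Definition _ := Topological.on weak_prob.

Definition metrizes (theta : weak_prob -> weak_prob -> R) : Prop :=
  [/\ (forall mu nu : probability (j.-tuple E) R,
         theta mu nu = 0 <-> same_measure mu nu),
      (forall mu nu, theta mu nu = theta nu mu),
      (forall mu nu xi, theta mu xi <= theta mu nu + theta nu xi) &
      (forall (mu : weak_prob) (U : set weak_prob),
         nbhs mu U <->
         exists2 e : R, 0 < e & [set nu | theta mu nu < e] `<=` U)].

End weak_convergence.

(* A space with this property need not be separable, but some metric spaces may
   lack it: if E is discrete and carries a {0,1}-valued probability, defined on
   all subsets and vanishing on singletons (a measurable cardinal), the weak
   topology on P(E) is not even first countable. *)
Definition weakly_metrizable (R : realType) d (E : borelMetricType R d) : Prop :=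
  forall j : nat, (1 <= j)%N ->
    exists theta : weak_prob E j -> weak_prob E j -> R, metrizes theta.

(* The convention Q_u = Q_0 for u < 0. *)
Definition clamp0 (R : realType) (u : R) : R := Num.max 0 u.

(* [pin n k j] and [pi u j] are the finite-dimensional laws of the array and of
   the stationary approximations; only n >= 1, k + j - 1 <= n, j >= 1 and u in
   [0, 1] are relevant. *)
Definition locally_stationary (R : realType) d (E : borelMetricType R d)
    (pin : nat -> int -> forall j : nat, probability (j.-tuple E) R)
    (pi : R -> forall j : nat, probability (j.-tuple E) R) : Prop :=
  forall j : nat, (1 <= j)%N ->
    exists theta : weak_prob E j -> weak_prob E j -> R,
      [/\ metrizes theta,
          {within `[0, 1], continuous (fun u : R => pi u j : weak_prob E j)} &
          ereal_sup [set (theta (pin n k j)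
                            (pi (clamp0 (k%:~R / n%:R)) j))%:E
                    | k in [set k : int | k <= n%:Z - j%:Z + 1]]
            @[n --> \oo] --> 0%E].

(* Main.v *)
(* If |f - f'| <= r for all pairs of values of f, the integrals of f against two
   probabilities at total variation distance c differ by at most r c; hence (A1)
   makes [Q_u^m] an r-contraction in total variation, and [Q_u] has a unique
   invariant probability by completeness. For the array, write [e_s] for
   [|u - s/n|^kappa] (with s/n clamped to [0, 1]) and [w] for [n^-kappa]: by (A2),
   going back m steps turns a bound c on the distance between the laws of [X_{n,k}]
   and [X_k(u)] into [r c + m L (e_k + m^kappa w)], an affine recursion whose
   iteration gives [a e_k + b w]; each further coordinate of a block adds one
   transition, that is at most [L e_s].
   Total variation neighbourhoods are finer than weak ones, and the uniformity
   over k in local stationarity comes from the compactness of [0, 1]. When E is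
   separable, the weak topology of P(E^j) is metrized by countably many integrals:
   every lower semicontinuous f : E^j -> [0, 1] is the supremum of finite maxima
   of rational cones centred at points of a countable dense set. *)

Require Import Defs.
From HB Require Import structures.
From mathcomp Require Import all_boot all_order all_algebra.
From mathcomp Require Import all_classical all_reals all_analysis.
From mathcomp Require Import measurable_realfun.
From mathcomp Require Import ring lra zify.

Set Implicit Arguments.
Unset Strict Implicit.
Unset Printing Implicit Defensive.

Import Order.TTheory GRing.Theory Num.Theory.
Import numFieldNormedType.Exports.

Local Open Scope classical_set_scope.
Local Open Scope ring_scope.

(** * Total variation and integrals *)

Section bounded_functions.
Context d (T : measurableType d) (R : realType).
Implicit Types (mu : probability T R) (f g : T -> R).

Lemma bounded_integrable mu f (M : R) :
  measurable_fun setT f -> (forall x, `|f x| <= M) ->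
  mu.-integrable setT (EFin \o f).
Proof.
move=> mf fM; apply: measurable_bounded_integrable => //.
  by apply: (le_lt_trans (probability_le1 _ _)); rewrite ?ltry.
by exists M; split => [|N MN x _ /=]; rewrite ?num_real// (le_trans (fM x))// ltW.
Qed.

Lemma unit_integrable mu f :
  measurable_fun setT f -> (forall x, 0 <= f x <= 1) ->
  mu.-integrable setT (EFin \o f).
Proof.
by move=> mf f01; apply: (@bounded_integrable _ _ 1) => // x; have := f01 x;
  rewrite ler_norml; lra.
Qed.

Lemma cst_integrable mu (c : R) : mu.-integrable setT (EFin \o cst c).
Proof. exact: (@bounded_integrable _ _ `|c|). Qed.

Lemma Rintegral_cst_prob mu (c : R) : (\int[mu]_x c = c)%R.
Proof. by rewrite Rintegral_cst// [X in fine X]probability_setT mulr1. Qed.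

Lemma Rintegral_indic mu A : measurable A -> (\int[mu]_x (\1_A x))%R = fine (mu A).
Proof. by move=> mA; rewrite /Rintegral integral_indic// setIT. Qed.

Lemma Rintegral_itv mu f (a b : R) :
  measurable_fun setT f -> (forall x, a <= f x <= b) ->
  a <= (\int[mu]_x f x)%R <= b.
Proof.
move=> mf fab.
have intf : mu.-integrable setT (EFin \o f).
  apply: (@bounded_integrable _ _ (`|a| + `|b|)) => // x.
  have := fab x; have := ler_norm b; have := ler_norm (- a).
  have := normr_ge0 b; have := normr_ge0 a.
  by rewrite normrN ler_norml; lra.
rewrite -[in X in X && _](Rintegral_cst_prob mu a).
rewrite -[in X in _ && X](Rintegral_cst_prob mu b).
by apply/andP; split; apply: le_Rintegral => //; try exact: cst_integrable;
  move=> x _; have /andP[] := fab x.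
Qed.

End bounded_functions.

(* On probability measures, [tv mu nu <= c%:E] stated with real numbers. *)
Definition tv_le d (T : measurableType d) (R : realType)
    (mu nu : set T -> \bar R) (c : R) : Prop :=
  forall A, measurable A -> `|fine (mu A) - fine (nu A)| <= c.

Section tv_le.
Context d (T : measurableType d) (R : realType).
Implicit Types (mu nu xi : probability T R).

(** Stated for bare set functions because [mact] carries no measure structure; finiteness on
    measurable sets allows the passage to real numbers. *)
Lemma tv_leP (mu nu : set T -> \bar R) (c : R) :
  (forall A, measurable A -> mu A \is a fin_num) ->
  (forall A, measurable A -> nu A \is a fin_num) ->
  (tv mu nu <= c%:E)%E <-> tv_le mu nu c.
Proof.
move=> fmu fnu; split=> [h A mA|h].
  have : (`|mu A - nu A| <= c%:E)%E.
    by apply: le_trans h; apply: ereal_sup_ubound; exists A.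
  by rewrite -(fineK (fmu _ mA)) -(fineK (fnu _ mA)) -EFinB abse_EFin lee_fin.
apply: ge_ereal_sup => _ [A mA <-].
rewrite -(fineK (fmu _ mA)) -(fineK (fnu _ mA)) -EFinB abse_EFin lee_fin.
exact: h.
Qed.

Lemma prob_fin mu A : measurable A -> mu A \is a fin_num.
Proof. by move=> mA; exact: fin_num_measure. Qed.

Lemma prob_fine_itv mu A : measurable A -> 0 <= fine (mu A) <= 1.
Proof.
move=> mA; rewrite fine_ge0 ?measure_ge0//=.
by rewrite -lee_fin fineK ?prob_fin// probability_le1.
Qed.

Lemma tv_le_prob mu nu (c : R) : (tv mu nu <= c%:E)%E <-> tv_le mu nu c.
Proof. by apply: tv_leP => A; exact: prob_fin. Qed.

Lemma tv_le1 mu nu : tv_le mu nu 1.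
Proof.
move=> A mA; have := prob_fine_itv mu mA; have := prob_fine_itv nu mA.
by rewrite ler_norml; lra.
Qed.

Lemma tv_le_refl (mu : set T -> \bar R) : tv_le mu mu 0.
Proof. by move=> A mA; rewrite subrr normr0. Qed.

Lemma tv_le_sym (mu nu : set T -> \bar R) (c : R) :
  tv_le mu nu c -> tv_le nu mu c.
Proof. by move=> h A mA; rewrite distrC h. Qed.

Lemma tv_le_trans (nu mu xi : set T -> \bar R) (a b : R) :
  tv_le mu nu a -> tv_le nu xi b -> tv_le mu xi (a + b).
Proof.
move=> h1 h2 A mA; rewrite (le_trans (ler_distD (fine (nu A)) _ _))//.
by rewrite lerD ?h1 ?h2.
Qed.

Lemma tv_le_weaken (mu nu : set T -> \bar R) (a b : R) :
  a <= b -> tv_le mu nu a -> tv_le mu nu b.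
Proof. by move=> ab h A mA; exact: le_trans (h _ mA) ab. Qed.

Lemma tv_le_eq (mu mu' nu nu' : set T -> \bar R) (c : R) :
  same_measure mu mu' -> same_measure nu nu' -> tv_le mu nu c ->
  tv_le mu' nu' c.
Proof. by move=> h1 h2 h A mA; rewrite -h1// -h2//; exact: h. Qed.

Lemma tv_le0 mu nu (c : R) : c <= 0 -> tv_le mu nu c -> same_measure mu nu.
Proof.
move=> c0 h A mA; have := le_trans (h _ mA) c0.
rewrite normr_le0 subr_eq0 => /eqP eqA.
by rewrite -(fineK (prob_fin mu mA)) eqA fineK// prob_fin.
Qed.

Lemma tv_le_limit (mu nu : set T -> \bar R) (c : R) :
  (forall e, 0 < e -> tv_le mu nu (c + e)) -> tv_le mu nu c.
Proof. by move=> h A mA; apply/ler_addgt0Pr => e e0; exact: h. Qed.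

Lemma Rintegral_sum_indic mu (N : nat) (A : nat -> set T) :
  (forall k, measurable (A k)) ->
  (\int[mu]_x \sum_(k < N) \1_(A k) x)%R = \sum_(k < N) fine (mu (A k)).
Proof.
move=> mA; elim: N => [|N IH].
  rewrite big_ord0 -[RHS](Rintegral_cst_prob mu).
  by apply: eq_Rintegral => x _; rewrite big_ord0.
rewrite big_ord_recr/= -IH -(Rintegral_indic mu (mA N)) -RintegralD//.
- by apply: eq_Rintegral => x _; rewrite big_ord_recr.
- apply: (@bounded_integrable _ _ _ _ _ N%:R).
    by apply: measurable_sum => k; exact: measurable_indic.
  move=> x; rewrite (le_trans (ler_norm_sum _ _ _))//.
  rewrite -[N in leRHS]card_ord -sumr_const ler_sum// => k _.
  by rewrite indicE; case: (_ \in _); rewrite ?normr1 ?normr0.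
- apply: unit_integrable; first exact: measurable_indic.
  by move=> x; rewrite indicE; case: (_ \in _); rewrite ?lexx ler01.
Qed.

(* The sum of the indicators of [f >= k/N], k = 1, ..., N, is the integer part
   of [N f]. *)
Lemma tv_le_Rintegral mu nu (c : R) (f : T -> R) :
  measurable_fun setT f -> (forall x, 0 <= f x <= 1) -> tv_le mu nu c ->
  `|(\int[mu]_x f x)%R - (\int[nu]_x f x)%R| <= c.
Proof.
move=> mf f01 h; apply/ler_addgt0Pr => e e0.
(* After multiplication by [N] the staircase errs by at most 1 in each integral, from the same side
   in both, so the comparison loses only [1 / N <= e]. *)
have [N N0 Ne] : exists2 N : nat, (0 < N)%N & 1 <= N%:R * e.
  exists (Num.truncn e^-1).+1 => //.
  rewrite -ler_pdivrMr// div1r.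
  by rewrite ltW// -truncn_lt_nat ?ltnSn// invr_ge0 ltW.
have N0' : 0 < N%:R :> R by rewrite ltr0n.
pose A k := [set x | k.+1%:R <= N%:R * f x].
have mA k : measurable (A k).
  rewrite /A -[X in measurable X]setTI.
  rewrite (_ : [set _ | _] = (fun x => N%:R * f x) @^-1` `[k.+1%:R, +oo[%classic).
    by apply: measurable_funM => //; exact: measurable_cst.
  by apply/seteqP; split => x /=; rewrite in_itv/= andbT.
have fA x : \sum_(k < N) \1_(A k) x <= N%:R * f x <= \sum_(k < N) \1_(A k) x + 1.
  have Nf0 : 0 <= N%:R * f x by rewrite mulr_ge0//; case/andP: (f01 x).
  have -> : \sum_(k < N) (\1_(A k) x : R) = (Num.truncn (N%:R * f x))%:R.
    transitivity (\sum_(k < N | (k < Num.truncn (N%:R * f x))%N) (1 : R)).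
      rewrite [RHS]big_mkcond/=; apply: eq_bigr => k _.
      rewrite indicE truncn_gt_nat.
      by case: ifP => hk; [rewrite mem_set|rewrite memNset//= /A/= hk].
    rewrite -(big_ord_widen _ (fun=> 1 : R)); last first.
      rewrite -(ler_nat R) (le_trans (y := N%:R * f x)) ?truncn_le//.
      by rewrite ler_piMr// ?ler0n//; case/andP: (f01 x).
    by rewrite sumr_const card_ord.
  by have /andP[-> /ltW] := truncn_itv Nf0; rewrite -addn1 natrD.
have intA mu' : mu'.-integrable setT (EFin \o (fun x => \sum_(k < N) (\1_(A k) x : R))).
  apply: (@bounded_integrable _ _ _ _ _ N%:R).
    by apply: measurable_sum => k; exact: measurable_indic.
  move=> x; rewrite (le_trans (ler_norm_sum _ _ _))//.
  rewrite -[N in leRHS]card_ord -sumr_const ler_sum// => k _.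
  by rewrite indicE; case: (_ \in _); rewrite ?normr1 ?normr0.
have key mu' : \sum_(k < N) fine (mu' (A k)) <= N%:R * (\int[mu']_x f x)%R <=
    \sum_(k < N) fine (mu' (A k)) + 1.
  rewrite -Rintegral_sum_indic//.
  have intf := unit_integrable mu' mf f01.
  rewrite -RintegralZl//.
  have intNf : mu'.-integrable setT (EFin \o (fun x => N%:R * f x)).
    by have := integrableZl measurableT N%:R intf; apply: eq_integrable.
  rewrite le_Rintegral//=; last by move=> x _; case/andP: (fA x).
  rewrite -[X in _ <= _ + X](Rintegral_cst_prob mu') -RintegralD//; last 2 first.
    exact: intA.
    exact: (cst_integrable mu' 1).
  apply: le_Rintegral => //; last by move=> x _; case/andP: (fA x).
  have := integrableD measurableT (intA mu') (cst_integrable mu' 1).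
  by apply: eq_integrable.
have sumc : `|\sum_(k < N) fine (mu (A k)) - \sum_(k < N) fine (nu (A k))| <= N%:R * c.
  rewrite -sumrB (le_trans (ler_norm_sum _ _ _))//.
  rewrite mulr_natl -[N in leRHS]card_ord -sumr_const ler_sum// => k _.
  exact: h.
rewrite -(ler_pM2l N0') -[X in X * `|_|](ger0_norm (ltW N0')) -normrM.
have := key mu; have := key nu; move: sumc.
by rewrite !ler_norml !(mulrBr, mulrDr); lra.
Qed.

(** Shifting and rescaling by the oscillation [b] reduces to values in [0, 1]; the shift cancels
    since both measures have mass 1. This is the source of the contraction in [tv_le_push]. *)
Lemma tv_le_osc mu nu (c a b : R) (f : T -> R) :
  measurable_fun setT f -> 0 <= b -> (forall x, a <= f x <= a + b) ->
  tv_le mu nu c ->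
  `|(\int[mu]_x f x)%R - (\int[nu]_x f x)%R| <= b * c.
Proof.
move=> mf; rewrite le_eqVlt => /predU1P[<-|b0] fab h.
  rewrite mul0r (_ : f = cst a) ?Rintegral_cst_prob ?subrr ?normr0//.
  by apply/funext => x /=; have := fab x; rewrite addr0; lra.
pose g x := b^-1 * (f x - a).
have mg : measurable_fun setT g.
  by apply: measurable_funM => //; apply: measurable_funB.
have g01 x : 0 <= g x <= 1.
  have := fab x; rewrite /g mulrC => /andP[fa fb].
  by rewrite divr_ge0 ?subr_ge0 ?(ltW b0)//= ler_pdivrMr// mul1r; lra.
have fg mu' : (\int[mu']_x f x)%R = b * (\int[mu']_x g x)%R + a.
  rewrite -RintegralZl//; last exact: unit_integrable.
  rewrite -[X in _ = _ + X](Rintegral_cst_prob mu') -RintegralD//.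
  - by apply: eq_Rintegral => x _; rewrite /g mulVKf ?gt_eqF// subrK.
  - have := integrableZl measurableT b (unit_integrable mu' mg g01).
    by apply: eq_integrable.
  - exact: cst_integrable.
rewrite !fg opprD addrACA subrr addr0 -mulrBr normrM (gtr0_norm b0).
by rewrite ler_pM2l//; exact: tv_le_Rintegral.
Qed.

End tv_le.

(** * Mixtures of kernels *)

Section mixture.
Context d d' (T : measurableType d) (S : measurableType d') (R : realType).
Variables (mu : probability T R) (K : R.-pker T ~> S).

Definition mixture (A : set S) : \bar R := (\int[mu]_x K x A)%E.

(** A kernel from the one-point space: [mixture] becomes a composition of kernels, which supplies
    sigma-additivity and the iterated integral. *)
Definition cst_kernel (_ : unit) : {measure set T -> \bar R} := mu.

Let measurable_cst_kernel U : measurable U ->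
  measurable_fun [set: unit] (cst_kernel ^~ U).
Proof. by move=> mU; exact: measurable_cst. Qed.

HB.instance Definition _ := isKernel.Build _ _ _ _ _ cst_kernel measurable_cst_kernel.

Let cst_kernel_prob x : cst_kernel x setT = 1%E.
Proof. by rewrite /cst_kernel [LHS]probability_setT. Qed.

HB.instance Definition _ :=
  Kernel_isProbability.Build _ _ _ _ _ cst_kernel cst_kernel_prob.

Let mixtureE : mixture = kcomp cst_kernel (@kernel.kernel_snd _ _ _ unit T S R K) tt.
Proof. by []. Qed.

Let mixture0 : mixture set0 = 0%E.
Proof. by rewrite mixtureE measure0. Qed.

Let mixture_ge0 A : (0 <= mixture A)%E.
Proof. by rewrite mixtureE measure_ge0. Qed.

Let mixture_sigma_additive : semi_sigma_additive mixture.
Proof. by rewrite mixtureE; exact: measure_semi_sigma_additive. Qed.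

HB.instance Definition _ := isMeasure.Build _ _ _ mixture
  mixture0 mixture_ge0 mixture_sigma_additive.

Let mixture_setT : mixture setT = 1%E.
Proof.
rewrite /mixture; under eq_integral do rewrite prob_kernel.
by rewrite integral_cst// [X in (_ * X)%E]probability_setT mule1.
Qed.

HB.instance Definition _ := Measure_isProbability.Build _ _ _ mixture mixture_setT.

Lemma integral_mixture (f : S -> \bar R) :
  (forall z, (0 <= f z)%E) -> measurable_fun setT f ->
  (\int[mixture]_z f z = \int[mu]_x \int[K x]_z f z)%E.
Proof.
exact: (@integral_kcomp _ _ _ unit T S R cst_kernel (kernel.kernel_snd K) tt f).
Qed.

End mixture.

Section mixture_tv.
Context d d' (T : measurableType d) (S : measurableType d') (R : realType).
Implicit Types (mu nu : probability T R) (K : R.-pker T ~> S).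

Lemma kernel_fin K x A : measurable A -> K x A \is a fin_num.
Proof. by move=> mA; exact: finite_kernel_measure. Qed.

Lemma kernel_fine_itv K x A : measurable A -> 0 <= fine (K x A) <= 1.
Proof.
move=> mA; rewrite fine_ge0 ?measure_ge0//= -lee_fin fineK ?kernel_fin//.
by rewrite -(prob_kernel (s := K) x) le_measure// inE.
Qed.

Lemma measurable_fine_kernel K A : measurable A ->
  measurable_fun setT (fun x => fine (K x A)).
Proof.
move=> mA; apply: (measurableT_comp (fine_measurable measurableT)).
exact: measurable_kernel.
Qed.

Lemma mixture_Rintegral mu K A : measurable A ->
  fine (mixture mu K A) = (\int[mu]_x fine (K x A))%R.
Proof.
move=> mA; rewrite /mixture /Rintegral; congr fine; apply: eq_integral => x _.
by rewrite fineK// kernel_fin.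
Qed.

Lemma tv_le_mixture mu nu K (c : R) :
  tv_le mu nu c -> tv_le (mixture mu K) (mixture nu K) c.
Proof.
move=> h A mA; rewrite !mixture_Rintegral//; apply: tv_le_Rintegral => //.
  exact: measurable_fine_kernel.
by move=> x; exact: kernel_fine_itv.
Qed.

Lemma tv_le_mixture_kernel mu K K' (e : R) :
  (forall x, tv_le (K x) (K' x) e) -> tv_le (mixture mu K) (mixture mu K') e.
Proof.
move=> h A mA; rewrite !mixture_Rintegral//.
have intK K0 : mu.-integrable setT (EFin \o (fun x => fine (K0 x A))).
  apply: unit_integrable; last by move=> x; exact: kernel_fine_itv.
  exact: measurable_fine_kernel.
rewrite -RintegralB// ler_norml; apply: Rintegral_itv.
  by apply: measurable_funB; exact: measurable_fine_kernel.
by move=> x; rewrite -ler_norml; exact: h.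
Qed.

Lemma tv_le_mixture2 mu nu K K' (c e : R) :
  tv_le mu nu c -> (forall x, tv_le (K x) (K' x) e) ->
  tv_le (mixture mu K) (mixture nu K') (c + e).
Proof.
move=> h hK; apply: (tv_le_trans (nu := mixture nu K)).
  exact: tv_le_mixture.
exact: tv_le_mixture_kernel.
Qed.

End mixture_tv.

(** * Iterates of a kernel and their contraction *)

Section kernel_powers.
Context d (E : measurableType d) (R : realType) (K : R.-pker E ~> E).
Implicit Types (mu nu : probability E R).

(** The measure [mu K^m] bundled as a probability, whereas [kpow] is a bare set function;
    [push_kpow] links the two. *)
Fixpoint push (m : nat) mu : probability E R :=
  if m is m'.+1 then push m' (mixture mu K) else mu.

Lemma pushS m mu : push m.+1 mu = mixture (push m mu) K :> probability E R.
Proof. by elim: m mu => // m IH mu; exact: (IH (mixture mu K)). Qed.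

Lemma push_add m n mu : push (m + n) mu = push m (push n mu).
Proof. by elim: n mu => [|n IH] mu; rewrite ?addn0// addnS/= IH. Qed.

Lemma same_measure_push m mu nu :
  same_measure mu nu -> same_measure (push m mu) (push m nu).
Proof.
move=> h; apply: (@tv_le0 _ _ _ _ _ 0) => //.
have {h} : tv_le mu nu 0 by apply: tv_le_eq (@tv_le_refl _ _ _ mu).
elim: m mu nu => // m IH mu nu h /=; apply: IH; exact: tv_le_mixture.
Qed.

Lemma kpow_ge0 m x A : (0 <= kpow K m x A)%E.
Proof.
by elim: m x => [|m IH] x /=; [exact: measure_ge0|apply: integral_ge0].
Qed.

Lemma measurable_kpow m A : measurable A -> measurable_fun setT (kpow K m ^~ A).
Proof.
move=> mA; elim: m => [|m IH] /=.
  by apply: measurable_fun_dirac.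
apply: measurable_fun_integral_kernel => //.
- by move=> U mU; exact: measurable_kernel.
- by move=> z; exact: kpow_ge0.
Qed.

Lemma push_kpow m mu A : measurable A ->
  push m mu A = (\int[mu]_x kpow K m x A)%E.
Proof.
move=> mA; elim: m mu => [|m IH] mu /=.
  rewrite (_ : (fun=> _) = fun x => (\1_A x)%:E).
    by rewrite integral_indic// setIT.
  by apply/funext => x; rewrite diracE.
rewrite IH integral_mixture//.
  by move=> z; exact: kpow_ge0.
exact: measurable_kpow.
Qed.

Lemma kpowE m x A : measurable A -> kpow K m x A = push m \d_x A.
Proof.
move=> mA; rewrite push_kpow// integral_dirac//.
  by rewrite diracT mul1e.
exact: measurable_kpow.
Qed.

Lemma invariant_push m mu : invariant_measure K mu -> same_measure (push m mu) mu.
Proof.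
move=> inv; elim: m => // m IH A mA /=.
rewrite -[RHS]IH//; apply: same_measure_push => // B mB; exact: inv.
Qed.

Context (m : nat) (r : R).
Hypothesis contr : forall x y : E,
  (tv (mact \d_x (kpow K m)) (mact \d_y (kpow K m)) <= r%:E)%E.

Let mactE x A : measurable A -> mact \d_x (kpow K m) A = push m \d_x A.
Proof. by move=> mA; rewrite push_kpow. Qed.

Lemma kpow_contr (x y : E) : tv_le (kpow K m x) (kpow K m y) r.
Proof.
have fin z A : measurable A -> mact \d_z (kpow K m) A \is a fin_num.
  by move=> mA; rewrite mactE// prob_fin.
have /(tv_leP _ (fin x) (fin y)) h := contr x y.
by move=> A mA; rewrite !kpowE// -!mactE//; exact: h.
Qed.

Lemma contr_ge0 : 0 <= r.
Proof.
by apply: le_trans (kpow_contr point point measurable0); exact: normr_ge0.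
Qed.

(** By (A1) the function [x |-> K^m(x, A)] oscillates by at most [r], so [tv_le_osc] multiplies the
    distance by [r]. *)
Lemma tv_le_push mu nu (c : R) :
  tv_le mu nu c -> tv_le (push m mu) (push m nu) (r * c).
Proof.
move=> h A mA.
pose f x := fine (kpow K m x A).
have fE x : (f x)%:E = kpow K m x A by rewrite /f kpowE// fineK// prob_fin.
have f01 x : 0 <= f x <= 1 by rewrite /f kpowE//; exact: prob_fine_itv.
have mf : measurable_fun setT f.
  by apply: (measurableT_comp (fine_measurable measurableT)); exact: measurable_kpow.
have pushE xi : fine (push m xi A) = (\int[xi]_x f x)%R.
  by rewrite push_kpow//; congr fine; apply: eq_integral => x _; rewrite fE.
rewrite !pushE.
have hinf : has_inf (range f).
  split; first by exists (f point); exists point.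
  by exists 0 => _ [x _ <-]; case/andP: (f01 x).
(* The infimum is the lower end: two values differ by at most [r], so every value lies at most [r]
   above it. *)
apply: (@tv_le_osc _ _ _ _ _ _ (inf (range f))) => //; first exact: contr_ge0.
move=> x; apply/andP; split; first by apply: ge_inf; [case: hinf|exists x].
rewrite -lerBlDr; apply: lb_le_inf; first by case: hinf.
move=> _ [y _ <-]; have := kpow_contr x y mA; rewrite -/(f x) -/(f y).
by rewrite ler_norml; lra.
Qed.

Lemma tv_le_push_iter k mu nu : tv_le (push (k * m) mu) (push (k * m) nu) (r ^+ k).
Proof.
elim: k mu nu => [|k IH] mu nu; first by rewrite expr0; exact: tv_le1.
rewrite mulSn exprS !push_add; exact: tv_le_push.
Qed.

End kernel_powers.

(** * Invariant probabilities *)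

Lemma exprn_small (R : realType) (r e : R) : 0 <= r < 1 -> 0 < e ->
  exists n, r ^+ n < e.
Proof.
move=> /andP[r0 r1] e0.
have : (fun n => r ^+ n) @ \oo --> (0 : R) by apply: cvg_expr; rewrite ger0_norm.
move=> /cvgrPdist_lt /(_ _ e0)[N _ /(_ N (leqnn N))] /=.
by rewrite sub0r normrN ger0_norm ?exprn_ge0// => h; exists N.
Qed.

(** * Completeness of probabilities in total variation, for geometric Cauchy sequences *)

Section tv_complete.
Context d (T : measurableType d) (R : realType).
Variables (mu : nat -> probability T R) (r : R).
Hypotheses (r01 : 0 <= r < 1)
  (cauchy_mu : forall n p, tv_le (mu (n + p)%N) (mu n) (r ^+ n)).

Let v A n := fine (mu n A) + r ^+ n.

(* Any value of the intersection of the intervals [mu n A - r^n, mu n A + r^n]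
   is the limit; this choice is nonnegative on nonmeasurable sets too. *)
Let l A : R := inf (range (v A)).

Let rn0 n : 0 <= r ^+ n. Proof. by rewrite exprn_ge0//; case/andP: r01. Qed.

Let v_ge0 A n : 0 <= v A n.
Proof. by rewrite addr_ge0// fine_ge0. Qed.

Let l_ge0 A : 0 <= l A.
Proof. by apply: lb_le_inf; [exists (v A 0), 0%N|move=> _ [n _ <-]; exact: v_ge0]. Qed.

Let l_approx A n : measurable A -> `|fine (mu n A) - l A| <= r ^+ n.
Proof.
move=> mA.
have lv : l A <= v A n.
  by apply: ge_inf; [exists 0 => _ [k _ <-]; exact: v_ge0|exists n].
have vl : fine (mu n A) - r ^+ n <= l A.
  apply: lb_le_inf; first by exists (v A 0), 0%N.
  move=> _ [k _ <-]; rewrite /v.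
  have := cauchy_mu n k mA; have := cauchy_mu k n mA; rewrite [(k + n)%N]addnC.
  by rewrite !ler_norml; lra.
by move: lv; rewrite /v ler_norml; lra.
Qed.

(** Limits are unique because [r ^+ n] tends to 0. Exact identities for [l] thus follow from those
    of the [mu n], up to a multiple of [r ^+ n]. *)
Let l_eq A (a : R) M : measurable A -> 0 <= M ->
  (forall n, `|fine (mu n A) - a| <= M * r ^+ n) -> l A = a.
Proof.
move=> mA M0 h; apply/eqP; rewrite -subr_eq0 -normr_le0; apply/ler_addgt0Pr => e e0.
have M1 : 0 < M + 1 by lra.
have [n ne] := exprn_small r01 (divr_gt0 e0 M1).
have -> : l A - a = (fine (mu n A) - a) + (l A - fine (mu n A)) by lra.
rewrite add0r.
rewrite (le_trans (ler_normD _ _))//.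
have := h n; have := l_approx n mA; rewrite [`|_ - l A|]distrC => h1 h2.
rewrite (le_trans (lerD h2 h1))// -[X in _ + X]mul1r -mulrDl.
by rewrite -ler_pdivlMl// mulrC ltW.
Qed.

Let m (A : set T) : \bar R := (l A)%:E.

Let m0 : m set0 = 0%E.
Proof.
congr EFin; apply: (l_eq (M := 0)) => // n.
by rewrite measure0 subrr normr0 mul0r.
Qed.

Let m_ge0 A : (0 <= m A)%E. Proof. by rewrite lee_fin. Qed.

Let l_additive (F : (set T)^nat) N : (forall i, measurable (F i)) -> trivIset setT F ->
  l (\big[setU/set0]_(i < N) F i) = \sum_(i < N) l (F i).
Proof.
move=> mF tF; apply: (l_eq (M := N%:R)) => //.
  by apply: bigsetU_measurable.
move=> n; rewrite measure_semi_additive_ord_I//; last 2 first.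
- by apply: sub_trivIset tF => i _.
- by apply: bigsetU_measurable.
rewrite -sum_fine; last by move=> i _; exact: prob_fin.
rewrite -sumrB (le_trans (ler_norm_sum _ _ _))//.
rewrite mulr_natl -[X in _ *+ X]card_ord -sumr_const ler_sum// => i _.
exact: l_approx.
Qed.

Let m_sigma_additive : semi_sigma_additive m.
Proof.
move=> F mF tF mU; rewrite /m.
under eq_fun do rewrite sumEFin big_mkord -l_additive//.
apply/cvg_EFin; first by near=> n.
apply/cvgrPdist_le => e e0.
(* One fixed [n] serves all [N]: the errors at the union and at the partial union are below [e / 4]
   each, and sigma-additivity of [mu n] gives the remaining [e / 2]. *)
have [n ne] := exprn_small r01 (divr_gt0 e0 (ltr0n R 4)).
have := @measure_semi_sigma_additive _ _ _ (mu n) F mF tF mU.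
have finU : mu n (\bigcup_i F i) \is a fin_num by exact: prob_fin.
rewrite -[X in _ --> X](fineK finU) => /fine_cvgP[_] /cvgrPdist_le /(_ (e / 2)).
have e2 : 0 < e / 2 by lra.
move=> /(_ e2); apply: filterS => N /=.
have mUN : measurable (\big[setU/set0]_(i < N) F i) by apply: bigsetU_measurable.
rewrite big_mkord -measure_semi_additive_ord_I//; last by apply: sub_trivIset tF.
have := l_approx n mU; have := l_approx n mUN.
by rewrite !ler_norml; lra.
Unshelve. all: by end_near. Qed.

HB.instance Definition _ := isMeasure.Build _ _ _ m m0 m_ge0 m_sigma_additive.

Let m_setT : m setT = 1%E.
Proof.
congr EFin; apply: (l_eq (M := 0)) => // n.
by rewrite [X in fine X]probability_setT subrr normr0 mul0r.
Qed.

HB.instance Definition _ := Measure_isProbability.Build _ _ _ m m_setT.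

Lemma tv_complete : exists pi : probability T R, forall n, tv_le (mu n) pi (r ^+ n).
Proof. by exists m => n A mA; exact: l_approx. Qed.

End tv_complete.

Section invariant_probability.
Context d (E : measurableType d) (R : realType) (K : R.-pker E ~> E).
Context (m : nat) (r : R).
Hypotheses (r1 : r < 1) (contr : forall x y : E,
  (tv (mact \d_x (kpow K m)) (mact \d_y (kpow K m)) <= r%:E)%E).

Lemma invariant_probability : exists2 pi : probability E R,
  invariant_measure K pi &
  forall nu : probability E R, invariant_measure K nu -> same_measure nu pi.
Proof.
have r01 : 0 <= r < 1 by rewrite (contr_ge0 contr).
pose mu n : probability E R := push K (n * m) \d_(point : E).
(* Sampling every [m] steps: [mu (n + p)] and [mu n] arise from two laws by the same [n * m] steps,
   hence are at distance at most [r ^+ n]. *)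
have [pi pi_lim] : exists pi : probability E R, forall n, tv_le (mu n) pi (r ^+ n).
  apply: tv_complete r01 _ => n p.
  by rewrite /mu mulnDl push_add; exact: tv_le_push_iter.
exists pi.
  (* Invariance: [pi K] is compared with [mu n K], then [mu n], then [pi], each time within
     [r ^+ n]. For the middle comparison, [mu n K] is obtained by [n * m] steps from
     [mixture \d_point K]. *)
  apply: (@tv_le0 _ _ _ (mixture pi K) pi 0) => //.
  apply: tv_le_limit => e e0; rewrite add0r.
  have e3 : 0 < e / 3 by lra.
  have [n ne] := exprn_small r01 e3.
  apply: (@tv_le_weaken _ _ _ _ _ (r ^+ n + (r ^+ n + r ^+ n))); first by lra.
  apply: (tv_le_trans (nu := mixture (mu n) K)).
    by apply: tv_le_sym; exact: tv_le_mixture.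
  apply: tv_le_trans (pi_lim n).
  apply: (@tv_le_eq _ _ _ (push K (n * m) (mixture \d_(point : E) K)) _ (mu n)) => //.
    have eqn := pushS K (n * m) \d_(point : E).
    by move=> A _; exact: (congr1 (fun xi : probability E R => xi A) eqn).
  exact: tv_le_push_iter.
(* Uniqueness: an invariant [nu] equals its image after [n * m] steps, which is within [r ^+ n] of
   [mu n]. *)
move=> nu nu_inv; apply: (@tv_le0 _ _ _ _ _ 0) => //.
apply: tv_le_limit => e e0; rewrite add0r.
have e2 : 0 < e / 2 by lra.
have [n ne] := exprn_small r01 e2.
apply: (@tv_le_weaken _ _ _ _ _ (r ^+ n + r ^+ n)); first by lra.
apply: tv_le_trans (pi_lim n).
apply: (@tv_le_eq _ _ _ (push K (n * m) nu) _ (mu n)) => //.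
  exact: invariant_push.
exact: tv_le_push_iter.
Qed.

End invariant_probability.

(** * Laws of Markov chains *)

Section tuple_rectangles.
Context d (E : measurableType d) (R : realType).
Variable G : set (set E).
Hypotheses (GE : @measurable d E = <<s G >>) (GT : G setT) (GI : setI_closed G).

Definition box n (A : 'I_n -> set E) : set (n.-tuple E) :=
  [set t | forall i, A i (tnth t i)].

Definition boxes n : set (set (n.-tuple E)) :=
  [set box A | A in [set A : 'I_n -> set E | forall i, G (A i)]].

Lemma boxE n (A : 'I_n -> set E) :
  box A = \big[setI/setT]_(i < n) ((@tnth n E ^~ i) @^-1` A i).
Proof.
apply/seteqP; split=> t.
  move=> At; apply: (big_ind (fun B : set _ => B t)) => [//|B C Bt Ct|i _].
    by split.
  exact: At.
by move=> At i; move: At; rewrite (bigD1 i)//= => -[].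
Qed.

Lemma measurable_box n (A : 'I_n -> set E) :
  (forall i, measurable (A i)) -> measurable (box A).
Proof.
move=> mA; rewrite boxE; apply: bigsetI_measurable => i _.
by rewrite -[X in measurable X]setTI; apply: measurable_tnth.
Qed.

Lemma boxesT n : boxes (n := n) setT.
Proof. by exists (fun=> setT) => //; apply/seteqP; split. Qed.

Lemma boxes_setI n : setI_closed (boxes (n := n)).
Proof.
move=> _ _ [A GA <-] [B GB <-]; exists (fun i => A i `&` B i).
  by move=> i; apply: GI.
by apply/seteqP; split=> t /=; [move=> h; split=> i; case: (h i)|case=> h1 h2 i; split].
Qed.

Lemma boxes_generate n : @measurable _ (n.-tuple E) = <<s boxes (n := n) >>.
Proof.
apply/seteqP; split; last first.
  apply: smallest_sub; first exact: sigma_algebra_measurable.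
  move=> _ [A GA <-]; apply: measurable_box => i.
  by rewrite GE; exact: sub_sigma_algebra.
(* The identity out of the sigma-field of boxes is measurable because each coordinate is: a
   constraint on one coordinate is a box whose other sides are [setT]. *)
pose T := g_sigma_algebraType (boxes (n := n)).
have mT : measurable_fun [set: T] (fun t : T => t : n.-tuple E).
  apply/measurable_fun_tnthP => i; apply: (measurability _ GE).
  move=> _ [A GA <-]; rewrite setTI; apply: sub_sigma_algebra.
  exists (fun i' => if i' == i then A else setT).
    by move=> i' /=; case: ifP.
  apply/seteqP; split=> t /=; first by move=> /(_ i); rewrite eqxx.
  by move=> Ai i'; case: eqVneq => // ->.
by move=> A mA; have := mT measurableT A mA; rewrite setTI.
Qed.

(** Boxes form a generating pi-system containing the whole space. [G] will be all measurable sets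
    for the Markov property, and the open sets for the weak topology. *)
Lemma same_measure_boxes n (mu nu : probability (n.-tuple E) R) :
  (forall A : 'I_n -> set E, (forall i, G (A i)) -> mu (box A) = nu (box A)) ->
  same_measure mu nu.
Proof.
move=> h A mA; apply: (measure_unique (boxes (n := n)) (fun=> setT)) => //.
- exact: boxes_generate.
- exact: boxes_setI.
- by move=> _; exact: boxesT.
- by rewrite bigcup_const//; exists 0%N.
- by move=> _ [B GB <-]; exact: h.
- by move=> _; rewrite [X in (X < _)%E]probability_setT ltry.
Qed.

End tuple_rectangles.

(** * Paths extended by one state *)

Section tuple_snoc.
Context d (E : measurableType d) (R : realType).

Definition snoc n (t : n.-tuple E) (y : E) : n.+1.-tuple E :=
  [tuple oapp (tnth t) y (unlift ord_max i) | i < n.+1].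

Lemma tnth_snoc_last n (t : n.-tuple E) y : tnth (snoc t y) ord_max = y.
Proof. by rewrite tnth_mktuple unlift_none. Qed.

Lemma tnth_snoc_lift n (t : n.-tuple E) y i :
  tnth (snoc t y) (lift ord_max i) = tnth t i.
Proof. by rewrite tnth_mktuple liftK. Qed.

Lemma box_snoc n (A : 'I_n.+1 -> set E) (t : n.-tuple E) y :
  box A (snoc t y) <-> box (fun i => A (lift ord_max i)) t /\ A ord_max y.
Proof.
split=> [h|[ht hy] i]; last first.
  by case: (unliftP ord_max i) => [i' ->|->]; rewrite ?tnth_snoc_lift ?tnth_snoc_last.
split=> [i|]; first by have := h (lift ord_max i); rewrite tnth_snoc_lift.
by have := h ord_max; rewrite tnth_snoc_last.
Qed.

Lemma measurable_snoc_pair n :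
  measurable_fun [set: n.-tuple E * E] (fun ty => snoc ty.1 ty.2).
Proof.
apply/measurable_fun_tnthP => i; case: (unliftP ord_max i) => [i' ->|->].
  rewrite (_ : _ \o _ = (@tnth n E ^~ i') \o fst).
    by apply: measurableT_comp => //; exact: measurable_tnth.
  by apply/funext => ty /=; rewrite tnth_snoc_lift.
rewrite (_ : _ \o _ = snd) //.
by apply/funext => ty /=; rewrite tnth_snoc_last.
Qed.

Lemma measurable_snoc n (t : n.-tuple E) : measurable_fun setT (snoc t).
Proof.
have := @measurable_fun_pair2 _ _ _ _ _ _ _ t (@measurable_snoc_pair n); exact.
Qed.

Variables (K : R.-pker E ~> E) (n : nat).

Definition last_kernel (t : n.+1.-tuple E) : {measure set E -> \bar R} :=
  K (tnth t ord_max).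

Let measurable_last_kernel U : measurable U ->
  measurable_fun setT (last_kernel ^~ U).
Proof.
move=> mU; apply: (@measurableT_comp _ _ _ _ _ _ (K ^~ U)).
  exact: measurable_kernel.
exact: measurable_tnth.
Qed.

HB.instance Definition _ :=
  isKernel.Build _ _ _ _ _ last_kernel measurable_last_kernel.

Let last_kernel_prob t : last_kernel t setT = 1%E.
Proof. exact: prob_kernel. Qed.

HB.instance Definition _ :=
  Kernel_isProbability.Build _ _ _ _ _ last_kernel last_kernel_prob.

Let snoc_image (t : n.+1.-tuple E) (U : set (n.+2.-tuple E)) : \bar R :=
  last_kernel t (snoc t @^-1` U).

Let snoc_image0 t : snoc_image t set0 = 0%E.
Proof. by rewrite /snoc_image preimage_set0 measure0. Qed.

Let snoc_image_ge0 t U : (0 <= snoc_image t U)%E.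
Proof. exact: measure_ge0. Qed.

Let snoc_image_sigma_additive t : semi_sigma_additive (snoc_image t).
Proof.
have mpre U : measurable U -> measurable (snoc t @^-1` U).
  by move=> mU; rewrite -[X in measurable X]setTI; exact: measurable_snoc.
move=> F mF tF mU; rewrite /snoc_image preimage_bigcup.
apply: measure_semi_sigma_additive.
- by move=> i; exact: mpre.
- apply/trivIsetP => /= i j _ _ ij; rewrite -preimage_setI.
  by move/trivIsetP : tF => /(_ _ _ _ _ ij) ->//; rewrite preimage_set0.
- by rewrite -preimage_bigcup; exact: mpre.
Qed.

HB.instance Definition _ t := isMeasure.Build _ _ _ (snoc_image t)
  (snoc_image0 t) (snoc_image_ge0 t) (@snoc_image_sigma_additive t).

(* The transition kernel of the growing path [(x_0, ..., x_n)]. *)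
Definition path_kernel (t : n.+1.-tuple E) : {measure set (n.+2.-tuple E) -> \bar R} :=
  snoc_image t.

Let measurable_path_kernel U : measurable U ->
  measurable_fun setT (path_kernel ^~ U).
Proof.
move=> mU.
(* The preimage of [U] under [snoc t] is the section at [t] of one measurable set of pairs, and
   kernels evaluate sections measurably. *)
rewrite (_ : (fun=> _) = fun t => last_kernel t
    (xsection ((fun ty : n.+1.-tuple E * E => snoc ty.1 ty.2) @^-1` U) t)).
  apply: measurable_fun_xsection_finite_kernel; rewrite inE.
  by rewrite -[X in measurable X]setTI; apply: measurable_snoc_pair.
by apply/funext => t; rewrite xsectionE.
Qed.

HB.instance Definition _ :=
  isKernel.Build _ _ _ _ _ path_kernel measurable_path_kernel.

Let path_kernel_prob t : path_kernel t setT = 1%E.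
Proof. by rewrite /path_kernel/= /snoc_image preimage_setT prob_kernel. Qed.

HB.instance Definition _ :=
  Kernel_isProbability.Build _ _ _ _ _ path_kernel path_kernel_prob.

Lemma path_kernel_box (A : 'I_n.+2 -> set E) t :
  path_kernel t (box A) =
  ((\1_(box (fun i => A (lift ord_max i))) t)%:E * K (tnth t ord_max) (A ord_max))%E.
Proof.
rewrite /path_kernel/= /snoc_image indicE.
have [tA|tA] := boolP (t \in _).
  rewrite mul1e; congr (K _ _); apply/seteqP; split=> y /=.
    by move=> /box_snoc[].
  by move=> Ay; apply/box_snoc; split => //; exact: set_mem.
rewrite mul0e -[RHS](measure0 (K (tnth t ord_max))); congr (K _ _).
apply/seteqP; split=> y //= /box_snoc[tA' _].
by move/negP: tA; apply; exact: mem_set.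
Qed.

End tuple_snoc.
Arguments path_kernel {d E R} K {n} t.

(** [path_kernel K t] is the image under [snoc t] of [K] at the last state, and taking images does
    not increase total variation. *)
Lemma tv_le_path_kernel d (E : measurableType d) (R : realType)
    (K K' : R.-pker E ~> E) (e : R) n :
  (forall x, tv_le (K x) (K' x) e) ->
  forall t, tv_le (path_kernel (n := n) K t) (path_kernel K' t) e.
Proof.
move=> h t A mA; apply: h.
by rewrite -[X in measurable X]setTI; apply: measurable_snoc.
Qed.

Section markov_laws.
Context dO (O : measurableType dO) d (E : measurableType d) (R : realType).
Variables (P : probability O R) (D : set int) (K : int -> R.-pker E ~> E)
  (X : int -> {RV P >-> E}).
Hypothesis markovX : markov_chain D K X.

Lemma markov_step k : D k ->
  same_measure (distribution P (X k))
               (mixture (distribution P (X (k - 1))) (K k)).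
Proof.
move=> Dk A mA; rewrite /mixture ge0_integral_distribution//; last first.
  exact: measurable_kernel.
rewrite -(markovX Dk mA (B := setT)) ?setTI//.
have [_ h _] := smallest_sigma_algebra setT
  [set X l @^-1` A | l in [set l : int | l < k] & A in measurable].
by rewrite -(setD0 setT); apply: h; exact: sigma_algebra0.
Qed.

Lemma blockS k n w : block X k n.+1 w = snoc (block X k n w) (X (k + n%:Z) w).
Proof.
apply: eq_from_tnth => i; case: (unliftP ord_max i) => [i' ->|->].
  by rewrite tnth_snoc_lift !tnth_mktuple lift_max.
by rewrite tnth_snoc_last tnth_mktuple.
Qed.

Lemma past_block k n (A : 'I_n -> set E) : (forall i, measurable (A i)) ->
  past X (k + n%:Z) (block X k n @^-1` box A).
Proof.
move=> mA; rewrite /past.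
set F := [set _ | _ in _ & _ in _].
suff : measurable ((block X k n : g_sigma_algebraType F -> _) @^-1` box A) by [].
rewrite boxE (big_morph _ (preimage_setI _) (preimage_setT _)).
apply: bigsetI_measurable => i _; apply: sub_sigma_algebra.
exists (k + i%:Z) => /=; first by rewrite ltrD2l ltz_nat.
exists (A i) => //.
by apply/seteqP; split=> w /=; rewrite tnth_mktuple.
Qed.

(** Checked on boxes, where it is the Markov identity: the first [n.+1] sides define a past event,
    the last side concerns the new state. *)
Lemma markov_block k n : D (k + n.+1%:Z) ->
  same_measure (law X k n.+2) (mixture (law X k n.+1) (path_kernel (K (k + n.+1%:Z)))).
Proof.
move=> Dk; apply: (@same_measure_boxes _ _ _ measurable) => //.
- exact: (esym (@sigma_algebra_id _ setT _ (sigma_algebra_measurable E))).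
- by move=> A B mA mB; exact: measurableI.
move=> A mA; pose A' i := A (lift ord_max i).
have mA' : forall i, measurable (A' i) by move=> i; exact: mA.
rewrite /mixture.
transitivity (\int[P]_w path_kernel (K (k + n.+1%:Z)) (block X k n.+1 w) (box A))%E;
    last first.
  apply/esym/(ge0_integral_distribution (block X k n.+1)) => //.
  by apply: measurable_kernel; exact: measurable_box.
transitivity (P ((block X k n.+1 @^-1` box A') `&` X (k + n.+1%:Z) @^-1` A ord_max)).
  congr (P _); apply/seteqP; split=> w /=.
    by rewrite blockS => /box_snoc.
  by rewrite [block X k n.+2 w]blockS => /box_snoc.
rewrite (markovX Dk (mA _) (past_block mA')).
rewrite integral_mkcond; apply: eq_integral => w _ /=.
rewrite [RHS]path_kernel_box patchE tnth_mktuple indicE.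
rewrite (_ : k + n.+1%:Z - 1 = k + n%:Z); last by rewrite -addn1 PoszD addrA addrK.
case: ifPn => hw.
  by rewrite mem_set ?mul1e//; exact: set_mem hw.
by rewrite memNset ?mul0e// => h; move/negP: hw; apply; exact: mem_set.
Qed.

Lemma law1 k : forall A, measurable A ->
  law X k 1 A = distribution P (X k) [set x | A [tuple x]].
Proof.
move=> A mA; congr (P _); apply/seteqP.
suff e w : block X k 1 w = [tuple X k w] by split=> w /=; rewrite e.
by apply: eq_from_tnth => i; rewrite tnth_mktuple !ord1 addr0.
Qed.

End markov_laws.

(** * Comparison of two Markov chains *)

(** [a] and [b = a * M / (1 - r)] solve the fixed-point equations [a = r a + m L] and
    [b = r b + a M] of the recursion over [m] steps; [L] pays for each further coordinate. The sum
    dominates all three coefficients. *)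
Definition tv_const (R : realType) (m : nat) (r L M : R) : R :=
  let a := m%:R * L / (1 - r) in a + a * M / (1 - r) + L.

Lemma tv_const_gt0 (R : realType) (m : nat) (r L M : R) :
  r < 1 -> 0 < L -> 0 <= M -> 0 < tv_const m r L M.
Proof.
move=> r1 L0 M0; have r1' : 0 <= 1 - r by rewrite subr_ge0 ltW.
have a0 : 0 <= m%:R * L / (1 - r) by rewrite divr_ge0// mulr_ge0// ltW.
by rewrite ltr_wpDl// addr_ge0// divr_ge0// mulr_ge0.
Qed.

Section coupling.
Context d (E : measurableType d) (R : realType).
Context dX (OX : measurableType dX) (PX : probability OX R) (X : int -> {RV PX >-> E}).
Context dY (OY : measurableType dY) (PY : probability OY R) (Y : int -> {RV PY >-> E}).
Variables (N : int) (K : int -> R.-pker E ~> E) (Q : R.-pker E ~> E).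
Hypotheses (markovX : markov_chain [set k : int | k <= N] K X)
  (markovY : markov_chain setT (fun=> Q) Y).
Variables (m : nat) (r L M w : R) (e : int -> R).
Hypotheses (r1 : r < 1) (L0 : 0 <= L) (M0 : 0 <= M) (w0 : 0 <= w)
  (e0 : forall s, 0 <= e s)
  (contr : forall x y : E,
    (tv (mact \d_x (kpow Q m)) (mact \d_y (kpow Q m)) <= r%:E)%E)
  (closeK : forall s x, s <= N -> tv_le (K s x) (Q x) (L * e s))
  (slow_e : forall k s, k <= N -> k - m%:Z <= s <= k -> e s <= e k + M * w).

Let muX k : probability E R := distribution PX (X k).
Let muY k : probability E R := distribution PY (Y k).

Let a := m%:R * L / (1 - r).
Let b := a * M / (1 - r).

Let pushY k i : same_measure (muY (k + i%:Z)) (push Q i (muY k)).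
Proof.
elim: i => [|i IH]; first by rewrite addr0.
rewrite pushS => A mA; rewrite [LHS](markov_step markovY (k := k + i.+1%:Z))//.
rewrite (_ : k + i.+1%:Z - 1 = k + i%:Z); last by rewrite -addn1 PoszD addrA addrK.
suff h : tv_le (mixture (muY (k + i%:Z)) Q) (mixture (push Q i (muY k)) Q) 0.
  exact: (tv_le0 (lexx 0) h mA).
apply: tv_le_mixture.
by apply: tv_le_eq (tv_le_refl (push Q i (muY k))) => // B mB; rewrite IH.
Qed.

(** Replacing [K s] by [Q] costs [L * e s] at each step, and [slow_e] bounds [e s] over the last [m]
    steps by [e k + M * w]. *)
Let pushX k i : k <= N -> (i <= m)%N ->
  tv_le (muX (k - m%:Z + i%:Z)) (push Q i (muX (k - m%:Z)))
    (i%:R * (L * (e k + M * w))).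
Proof.
move=> kN; elim: i => [_|i IH im].
  by rewrite addr0 mul0r; exact: tv_le_refl.
have si : k - m%:Z <= k - m%:Z + i.+1%:Z <= k.
  by rewrite lerDl lez_nat/= -addrA gerDl addrC subr_le0 lez_nat.
have sN : k - m%:Z + i.+1%:Z <= N by case/andP: si => _ /le_trans; apply.
apply: (tv_le_eq _ _ (mu := mixture (muX (k - m%:Z + i%:Z)) (K (k - m%:Z + i.+1%:Z)))
  (nu := mixture (push Q i (muX (k - m%:Z))) Q)).
- move=> A mA; rewrite [RHS](markov_step markovX (k := k - m%:Z + i.+1%:Z))//.
  by rewrite (_ : _ + i.+1%:Z - 1 = k - m%:Z + i%:Z)// -addn1 PoszD addrA addrK.
- have eqn := pushS Q i (muX (k - m%:Z)).
  by move=> A _; exact: (congr1 (fun xi : probability E R => xi A) (esym eqn)).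
rewrite -[in X in X * _]addn1 natrD mulrDl mul1r.
apply: tv_le_mixture2; first by apply: IH; exact: ltnW.
move=> x; apply: tv_le_weaken (closeK x sN).
by rewrite ler_wpM2l// slow_e.
Qed.

(* One pass through [m] steps turns the bound [c] into
   [r c + m L (e k + M w)]; [a] and [b] make [a e_k + b w] stable under it. *)
Let tv_le_marginal_iter n k : k <= N ->
  tv_le (muX k) (muY k) (a * e k + b * w + r ^+ n).
Proof.
have r0 : 0 <= r := contr_ge0 contr.
have r1' : 0 < 1 - r by rewrite subr_gt0.
have a0 : 0 <= a by rewrite divr_ge0 ?mulr_ge0// ltW.
have b0 : 0 <= b := divr_ge0 (mulr_ge0 a0 M0) (ltW r1').
have aE : a * (1 - r) = m%:R * L by rewrite divfK// lt0r_neq0.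
have bE : b * (1 - r) = a * M by rewrite divfK// lt0r_neq0.
(* [k] stays general: there is no initial time, so a jump back by [m] is always possible. The start
   is the trivial bound [1 = r ^+ 0]. *)
elim: n k => [|n IH] k kN.
  rewrite expr0; apply: (tv_le_weaken _ (tv_le1 (muX k) (muY k))).
  by rewrite lerDr addr_ge0// mulr_ge0.
have km : k - m%:Z <= N by rewrite (le_trans _ kN)// gerDl oppr_le0.
have kk : k - m%:Z + m%:Z = k by rewrite subrK.
have hY : same_measure (push Q m (muY (k - m%:Z))) (muY k).
  by move=> A mA; rewrite -[k in RHS]kk pushY.
have hX := pushX kN (leqnn m); rewrite kk in hX.
apply: (@tv_le_eq _ _ _ (muX k) _ (push Q m (muY (k - m%:Z)))) => //.
have := tv_le_trans hX (tv_le_push contr (IH _ km)).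
apply: tv_le_weaken.
have h1 : e (k - m%:Z) <= e k + M * w.
  by apply: slow_e => //; rewrite lexx gerDl oppr_le0.
have h2 : r * a * e (k - m%:Z) <= r * a * (e k + M * w).
  by rewrite ler_wpM2l// mulr_ge0.
rewrite exprS mulrA -aE (mulrDr r) (mulrDr r).
have h3 : (a * (1 - r) + r * a) * (M * w) = b * (1 - r) * w by rewrite bE; ring.
have h4 : a * (1 - r) * (e k + M * w) = a * e k * (1 - r) + a * (1 - r) * (M * w) by ring.
move: h2 h3 h4; lra.
Qed.

Lemma tv_le_marginal k : k <= N -> tv_le (muX k) (muY k) (a * e k + b * w).
Proof.
move=> kN; apply: tv_le_limit => e' e'0.
have [n rn] : exists n, r ^+ n < e'.
  by apply: exprn_small => //; rewrite (contr_ge0 contr).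
by apply: tv_le_weaken (tv_le_marginal_iter n kN); rewrite lerD2l ltW.
Qed.

Lemma tv_le_law j k : k + j%:Z <= N ->
  tv_le (law X k j.+1) (law Y k j.+1)
    (a * e k + b * w + L * \sum_(i < j) e (k + i.+1%:Z)).
Proof.
elim: j => [|j IH] kjN.
  rewrite big_ord0 mulr0 addr0 => A mA.
  rewrite addr0 in kjN.
  have m1 : measurable_fun setT (fun x : E => [tuple x]).
    apply/measurable_fun_tnthP => i; rewrite (_ : _ \o _ = id)//.
    by apply/funext => x /=; rewrite ord1.
  have mA1 : measurable [set x : E | A [tuple x]].
    by rewrite -[X in measurable X]setTI; apply: m1.
  rewrite (le_trans _ (tv_le_marginal kjN mA1))// le_eqVlt; apply/orP; left.
  by apply/eqP; congr (`|fine _ - fine _|); exact: law1.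
rewrite big_ord_recr/= mulrDr addrA.
apply: (tv_le_eq _ _ (mu := mixture (law X k j.+1) (path_kernel (K (k + j.+1%:Z))))
  (nu := mixture (law Y k j.+1) (path_kernel Q))).
- by move=> A mA; rewrite (markov_block markovX).
- by move=> A mA; rewrite (markov_block markovY).
apply: tv_le_mixture2.
  by apply: IH; rewrite (le_trans _ kjN)// lerD2l lez_nat.
by apply: tv_le_path_kernel => x; exact: closeK.
Qed.

(** [e], [w] and [M] are abstract to cover two uses: the array, with [M = m^kappa] and
    [w = n^-kappa], and two stationary chains, with [e] constant and [w = 0]. *)
Lemma tv_le_coupling j k : k + j%:Z <= N ->
  tv_le (law X k j.+1) (law Y k j.+1)
    (tv_const m r L M * (\sum_(i < j.+1) e (k + i%:Z) + w)).
Proof.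
move=> kjN; apply: tv_le_weaken (tv_le_law kjN).
have r1' : 0 < 1 - r by rewrite subr_gt0.
have a0 : 0 <= a by rewrite divr_ge0 ?mulr_ge0// ltW.
have b0 : 0 <= b := divr_ge0 (mulr_ge0 a0 M0) (ltW r1').
rewrite big_ord_recl addr0 /tv_const -/a -/b.
set S := \sum_(i < j) _; have S0 : 0 <= S by apply: sumr_ge0.
have := mulr_ge0 a0 S0; have := mulr_ge0 b0 S0; have := mulr_ge0 L0 w0.
have := mulr_ge0 a0 w0; have := mulr_ge0 b0 (e0 k); have := mulr_ge0 L0 (e0 k).
by rewrite !(mulrDr, mulrDl); lra.
Qed.

End coupling.

(** * Weak topology *)

Section evaluation_topology.
Context (S : choiceType) (I : Type) (T : I -> topologicalType).

Lemma eval_continuous i : continuous (fun f : prod_topology T => f i).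
Proof.
move=> f U fU.
have /cvg_sup : nbhs f --> f by [].
move=> /(_ i); apply.
exact: (@initial_continuous _ _ (fun f : forall i, T i => f i) f U fU).
Qed.

Variable phi : S -> prod_topology T.

Lemma initial_eval_continuous i :
  continuous (fun x : initial_topology phi => phi x i).
Proof.
move=> x; apply: (@continuous_comp _ _ _ (phi : initial_topology phi -> _)
  (fun f : prod_topology T => f i)).
  exact: initial_continuous.
exact: eval_continuous.
Qed.

(** Open sets of the initial topology are preimages, and convergence in a product is coordinatewise.
    Serves both for tuples and for [weak_prob]. *)
Lemma cvg_initial_eval (F : set_system S) (x : initial_topology phi) :
  Filter F -> (forall i, phi y i @[y --> F] --> phi x i) -> F --> x.
Proof.
move=> FF h U [B [[C oC CB] Bx BU]].
have hF : phi @ F --> phi x.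
  apply/cvg_sup => i V [W [[Z oZ ZW] Wx WV]].
  rewrite /= nbhs_filterE; apply: filterS WV _; rewrite -ZW.
  apply: (h i); apply: open_nbhs_nbhs; split => //.
  by move: Wx; rewrite -ZW.
apply: (filterS BU); rewrite -CB; apply: hF; apply: open_nbhs_nbhs; split=> //.
by move: Bx; rewrite -CB.
Qed.

End evaluation_topology.

Section total_variation_topology.
Context (R : realType) d (E : borelMetricType R d) (j : nat).
Implicit Types (mu nu : probability (j.-tuple E) R).

(** The filter of total variation balls around [mu] converges weakly: a test function bounded by
    [M'] oscillates by at most [2 * M'], so its integrals move by at most [2 * M'] times the
    radius. *)
Lemma nbhs_weak_tv (mu : weak_prob E j) (U : set (weak_prob E j)) :
  nbhs mu U -> exists2 e : R, 0 < e & forall nu, tv_le nu mu e -> U nu.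
Proof.
pose F : set_system (weak_prob E j) := filter_from [set e : R | 0 < e]
  (fun e => [set nu : weak_prob E j | tv_le nu mu e]).
have FF : Filter F.
  apply: filter_from_filter; first by exists 1 => /=.
  move=> e1 e2 /= e10 e20; exists (Num.min e1 e2); first by rewrite lt_min e10.
  by move=> nu h; split; apply: tv_le_weaken h; rewrite ge_min lexx ?orbT.
suff h : F --> mu by move=> /h [e e0 he]; exists e.
apply: cvg_initial_eval => -[f [cf mf [M fM]]].
apply/cvgrPdist_le => e e0.
pose M' := `|M| + 1; have M'0 : 0 < M' by rewrite ltr_pwDr.
exists (e / (2 * M')); first by rewrite /= divr_gt0 ?mulr_gt0.
move=> nu /= h; rewrite distrC.
have -> : e = 2 * M' * (e / (2 * M')) by rewrite mulrC divfK// gt_eqF ?mulr_gt0.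
apply: (@tv_le_osc _ _ _ _ _ _ (- M')) => //.
  by rewrite mulr_ge0// ltW.
move=> x /=; have : `|f x| <= M'.
  by rewrite (le_trans (fM x))// (le_trans (ler_norm _))// lerDl.
by rewrite ler_norml; lra.
Qed.

End total_variation_topology.

(** * Continuity and measurability of distances on finite products *)

Section metric_measurability.
Context (R : realType) d (E : borelMetricType R d).

Lemma open_measurableE (O : set E) : open O -> measurable O.
Proof. by move=> oO; rewrite (borelE (s := E)); exact: sub_sigma_algebra. Qed.

Lemma mdist_continuous (c : E) : continuous (mdist c).
Proof.
move=> x; apply/cvgrPdist_lt => e e0.
near=> y; have : ball x e y by near: y; exact: nbhsx_ballx.
rewrite ballEmdist/= => xy; have := metric_triangle c x y.
have := metric_triangle c y x; rewrite (metric_sym y x) => h1 h2.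
by rewrite ltr_norml; lra.
Unshelve. all: by end_near. Qed.

Lemma measurable_mdist (c : E) : measurable_fun setT (mdist c).
Proof.
apply: (measurability _ (RGenOInfty.measurableE R)) => _ [_ [x ->] <-].
rewrite setTI; apply: open_measurableE.
apply: open_comp; last exact: interval_open.
by move=> y _; exact: mdist_continuous.
Qed.

Variable j : nat.

Lemma tnth_continuous i : continuous (fun t : j.-tuple E => tnth t i).
Proof. exact: initial_eval_continuous. Qed.

(** The sum metric, compatible with the product topology by [dist1_continuous] and [nbhs_dist1]. *)
Definition dist1 (s t : j.-tuple E) : R := \sum_(i < j) mdist (tnth s i) (tnth t i).

Lemma dist1_ge0 s t : 0 <= dist1 s t.
Proof. by apply: sumr_ge0 => i _; exact: mdist_ge0. Qed.

Lemma dist1_triangle s t u : dist1 s u <= dist1 s t + dist1 t u.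
Proof. by rewrite -big_split; apply: ler_sum => i _; exact: metric_triangle. Qed.

Lemma dist1_continuous s : continuous (dist1 s).
Proof.
pose f (r : seq 'I_j) (u : j.-tuple E) := \sum_(i <- r) mdist (tnth s i) (tnth u i).
suff : forall r, continuous (f r) by exact.
elim=> [|i r IH] t.
  have -> : f [::] = cst 0 by apply/funext => u; rewrite /f big_nil.
  exact: cst_continuous.
have -> : f (i :: r) = fun u => mdist (tnth s i) (tnth u i) + f r u.
  by apply/funext => u; rewrite /f big_cons.
have h : continuous (fun u : j.-tuple E => mdist (tnth s i) (tnth u i)).
  move=> u; apply: (@continuous_comp _ _ _ (fun t : j.-tuple E => tnth t i)
    (mdist (tnth s i))).
    exact: tnth_continuous.
  exact: mdist_continuous.
exact: (@continuousD R R^o _ _ _ t (h t) (IH t)).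
Qed.

Lemma measurable_dist1 s : measurable_fun setT (dist1 s).
Proof.
apply: measurable_sum => i.
apply: (@measurableT_comp _ _ _ _ _ _ (mdist (tnth s i))).
  exact: measurable_mdist.
exact: measurable_tnth.
Qed.

Lemma nbhs_dist1 (t : j.-tuple E) (U : set (j.-tuple E)) :
  nbhs t U -> exists2 e, 0 < e & forall u, dist1 t u < e -> U u.
Proof.
pose F : set_system (j.-tuple E) := filter_from [set e : R | 0 < e]
  (fun e => [set u | dist1 t u < e]).
have FF : Filter F.
  apply: filter_from_filter; first by exists 1 => /=.
  move=> e1 e2 /= e10 e20; exists (Num.min e1 e2); first by rewrite lt_min e10.
  by move=> u /=; rewrite lt_min => /andP.
suff h : F --> t by move=> /h [e e0 he]; exists e.
apply: cvg_initial_eval => i U' /nbhs_ballP[e /= e0 eU'].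
exists e => // u /= tu; apply: eU'; rewrite ballEmdist/=.
apply: le_lt_trans tu; rewrite /dist1 (bigD1 i)//= lerDl sumr_ge0// => k _.
exact: mdist_ge0.
Qed.

End metric_measurability.

(** * Metrizability for separable spaces *)

Section countable_weak_metric.
Context (R : realType) d (E : borelMetricType R d) (j : nat).
Variable a : nat -> E.
Hypothesis dense_a : forall (x : E) (e : R), 0 < e -> exists n, mdist (a n) x < e.
Implicit Types (mu nu : probability (j.-tuple E) R) (f : j.-tuple E -> R).

(* [(q, l, c)] encodes the cone of apex [q] and slope [l] centred at the point
   with coordinates [a (c_i)]. *)
Definition cone_code : Type := (rat * nat * j.-tuple nat)%type.

HB.instance Definition _ := Countable.on cone_code.

Definition cone_center (b : cone_code) : j.-tuple E :=
  [tuple a (tnth b.2 i) | i < j].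

Definition cone (b : cone_code) (t : j.-tuple E) : R :=
  ratr b.1.1 - b.1.2%:R * dist1 (cone_center b) t.

Definition cones (s : seq cone_code) (t : j.-tuple E) : R :=
  Num.min 1 (\big[Num.max/0]_(b <- s) cone b t).

Lemma cones_itv s t : 0 <= cones s t <= 1.
Proof.
rewrite /cones ge_min lexx/= andbT le_min ler01/=.
elim: s => [|b s IH]; first by rewrite big_nil.
by rewrite big_cons le_max IH orbT.
Qed.

Lemma cones_le f s t : 0 <= f t -> (forall b, b \in s -> cone b t <= f t) ->
  cones s t <= f t.
Proof.
move=> f0 h; rewrite /cones ge_min; apply/orP; right.
by rewrite big_seq; apply: bigmax_le.
Qed.

Lemma cones_ge s b t : b \in s -> cone b t <= 1 -> cone b t <= cones s t.
Proof.
move=> bs b1; rewrite /cones le_min b1/=.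
exact: (@le_bigmax_seq _ _ _ s 0 b xpredT (cone ^~ t)).
Qed.

Lemma cone_continuous b : continuous (cone b).
Proof.
move=> t; apply: (@continuousB R R^o _ (cst _)
  (fun u => b.1.2%:R * dist1 (cone_center b) u)); first exact: cst_continuous.
apply: (@continuousM R _ (cst _)); first exact: cst_continuous.
exact: dist1_continuous.
Qed.

Lemma cones_continuous s : continuous (cones s).
Proof.
move=> t; apply: continuous_min; first exact: cst_continuous.
pose g (s : seq cone_code) (u : j.-tuple E) := \big[Num.max/0]_(b <- s) cone b u.
suff : forall s, continuous (g s) by exact.
elim=> {t s} [|b s IH] t.
  have -> : g [::] = cst 0 by apply/funext => u; rewrite /g big_nil.
  exact: cst_continuous.
have -> : g (b :: s) = fun u => Num.max (cone b u) (g s u).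
  by apply/funext => u; rewrite /g big_cons.
by apply: continuous_max; [exact: cone_continuous|exact: IH].
Qed.

Lemma measurable_cones s : measurable_fun setT (cones s).
Proof.
apply: measurable_minr => //.
elim: s => [|b s IH].
  rewrite (_ : (fun=> _) = cst 0); first exact: measurable_cst.
  by apply/funext => u; rewrite big_nil.
rewrite (_ : (fun=> _) = fun u => Num.max (cone b u)
    (\big[Num.max/0]_(b <- s) cone b u)); last first.
  by apply/funext => u; rewrite big_cons.
apply: measurable_maxr => //; apply: measurable_funB => //.
by apply: measurable_funM => //; exact: measurable_dist1.
Qed.

(** Lower semicontinuity covers both uses below: indicators of open boxes, which separate laws, and
    continuous test functions. *)
Definition lsc f := forall t (c : R), c < f t ->
  exists2 e, 0 < e & forall u, dist1 t u < e -> c < f u.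

(** The apex [q] is taken just below a level that [f] exceeds on a ball around [t], and the slope is
    steep enough for the cone to be negative outside this ball. *)
Lemma cone_approx f t (e : R) : (forall u, 0 <= f u <= 1) -> lsc f -> 0 < e -> e < f t ->
  exists2 b, (forall u, cone b u <= f u) & f t - e <= cone b t.
Proof.
move=> f01 lscf e0 eft.
have [delta delta0 hdelta] : exists2 delta, 0 < delta &
    forall u, dist1 t u < delta -> f t - e / 2 < f u.
  by apply: lscf; rewrite ltrBlDr ltrDl divr_gt0.
have [q] : exists q, ratr q \in `](f t - e / 2 - e / 4), (f t - e / 2)[%R.
  by apply: rat_in_itvoo; rewrite ltrBlDr ltrDl divr_gt0.
rewrite in_itv/= => /andP[q1 q2].
(* Outside the [delta]-ball of [t], the centre is at least [delta / 2] away; this slope then makes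
   the cone drop by more than 1, and [q < 1]. *)
pose l := (Num.truncn (2 / delta)).+1.
have lE : 1 < l%:R * (delta / 2).
  have : 2 / delta < l%:R by rewrite -truncn_lt_nat// ltW// divr_gt0.
  by rewrite ltr_pdivrMr// => h; lra.
have l0 : 0 < l%:R :> R by rewrite ltr0n.
(* The bound [delta / 2] serves the slope; [e / 4 / l] limits the drop of the cone at [t] to
   [e / 4], on top of the [3 e / 4] lost by [q]. *)
have [c hc] : exists c : j.-tuple nat,
    dist1 [tuple a (tnth c i) | i < j] t <= Num.min (delta / 2) (e / 4 / l%:R).
  have : 0 < Num.min (delta / 2) (e / 4 / l%:R) by rewrite lt_min !divr_gt0.
  move: (Num.min _ _) => M M0.
  (* [j.+1] rather than [j] avoids a division by 0 for empty tuples. *)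
  have eta0 : 0 < M / j.+1%:R by rewrite divr_gt0// ltr0n.
  have ch i := cid (dense_a (tnth t i) eta0).
  exists [tuple sval (ch i) | i < j]; rewrite /dist1.
  apply: (@le_trans _ _ (\sum_(i < j) (M / j.+1%:R))).
    by apply: ler_sum => i _; rewrite !tnth_mktuple; exact: ltW (svalP (ch i)).
  rewrite sumr_const card_ord -[_ *+ j]mulr_natr mulrAC ler_pdivrMr ?ltr0n//.
  by rewrite ler_pM2l ?ler_nat.
move: hc; rewrite le_min => /andP[c1 c2].
have c2' : l%:R * dist1 [tuple a (tnth c i) | i < j] t <= e / 4.
  by rewrite mulrC -ler_pdivlMr.
exists (q, l, c); last by rewrite /cone/= /cone_center/=; lra.
move=> u; rewrite /cone/= /cone_center/=; set z := [tuple _ | _ < _] in c1 c2 c2' *.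
have [tu|tu] := ltP (dist1 t u) delta.
  have := hdelta _ tu; have := mulr_ge0 (ltW l0) (dist1_ge0 z u); lra.
have h1 : dist1 t z + dist1 z u >= delta := le_trans tu (dist1_triangle t z u).
have sym : dist1 t z = dist1 z t.
  by apply: eq_bigr => i _; exact: metric_sym.
have h2 : l%:R * (delta / 2) <= l%:R * dist1 z u by rewrite ler_pM2l//; lra.
by have := f01 u; have := f01 t; lra.
Qed.

(* By dominated convergence along the finite maxima of the cones below [f]. *)
Lemma cones_Rintegral mu f (e : R) : measurable_fun setT f ->
  (forall u, 0 <= f u <= 1) -> lsc f -> 0 < e ->
  exists2 s, (forall u, cones s u <= f u) &
    (\int[mu]_u f u)%R - e <= (\int[mu]_u cones s u)%R.
Proof.
move=> mf f01 lscf e0.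
pose s N := [seq b <- pmap unpickle (iota 0 N) | `[< forall u, cone b u <= f u >]].
have sf N u : cones (s N) u <= f u.
  apply: cones_le; first by case/andP: (f01 u).
  by move=> b; rewrite mem_filter => /andP[/asboolP].
have s_cvg u : cones (s N) u @[N --> \oo] --> f u.
  apply/cvgrPdist_le => eta eta0.
  (* Where [f u <= eta], nonnegativity of [cones] is enough; elsewhere one good cone belongs to
     [s N] as soon as [N] exceeds its index. *)
  have [fu|fu] := ltP eta (f u); last first.
    near=> N; have := sf N u; have /andP[c0 _] := cones_itv (s N) u.
    by rewrite ger0_norm ?subr_ge0 ?sf//; lra.
  have [b bf bu] := cone_approx f01 lscf eta0 fu.
  exists (pickle b).+1 => // N /= bN.
  have bs : b \in s N.
    rewrite mem_filter; apply/andP; split; first exact/asboolP.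
    by rewrite mem_pmap -(pickleK b) map_f// mem_iota.
  have := cones_ge bs (le_trans (bf u) (proj2 (andP (f01 u)))).
  by have := sf N u; rewrite ger0_norm ?subr_ge0 ?sf//; lra.
have cvgI : (\int[mu]_u cones (s N) u)%R @[N --> \oo] --> (\int[mu]_u f u)%R.
  apply: fine_cvg; rewrite fineK; last first.
    by apply: integrable_fin_num => //; exact: unit_integrable.
  have [] // := @dominated_convergence _ _ _ mu _ measurableT
    (fun N => EFin \o cones (s N)) (EFin \o f) (cst 1%E).
  - by move=> N; apply/measurable_EFinP; exact: measurable_cones.
  - exact/measurable_EFinP.
  - by apply: aeW => u _; apply: cvg_EFin; [near=> N|exact: s_cvg].
  - exact: (cst_integrable mu 1).
  - apply: aeW => u N _ /=; rewrite lee_fin.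
    by have /andP[c0 c1] := cones_itv (s N) u; rewrite ger0_norm.
move/cvgrPdist_le : cvgI => /(_ _ e0)[N _ /(_ N (leqnn N))] /= h.
exists (s N) => //; move: h; rewrite ler_norml; lra.
Unshelve. all: by end_near. Qed.

Let half_pow n : 0 < (2^-1 : R) ^+ n <= 1.
Proof. by rewrite exprn_gt0 ?exprn_ile1 ?invr_gt0//; lra. Qed.

(** The weight tends to 0 along the enumeration of lists, so that up to any error finitely many
    integrals control the supremum of the gaps. *)
Let gap s mu nu := 2^-1 ^+ pickle s *
  `|(\int[mu]_u cones s u)%R - (\int[nu]_u cones s u)%R|.

Let gap_le s mu nu : gap s mu nu <= 2^-1 ^+ pickle s.
Proof.
rewrite /gap ler_piMr ?exprn_ge0//.
have := Rintegral_itv mu (measurable_cones s) (cones_itv s).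
have := Rintegral_itv nu (measurable_cones s) (cones_itv s).
by rewrite ler_norml; lra.
Qed.

Definition cone_metric (mu nu : weak_prob E j) : R :=
  sup [set gap s mu nu | s in setT].

Let gap_sup s mu nu : gap s mu nu <= cone_metric mu nu.
Proof.
apply: ub_le_sup; last by exists s.
exists 1 => _ [s' _ <-]; rewrite (le_trans (gap_le s' mu nu))//.
by case/andP: (half_pow (pickle s')).
Qed.

Let cone_metric_le mu nu (c : R) :
  (forall s, gap s mu nu <= c) -> cone_metric mu nu <= c.
Proof.
by move=> h; apply: ge_sup; [exists (gap [::] mu nu), [::]|move=> _ [s _ <-]].
Qed.

Lemma cone_metric_ge0 mu nu : 0 <= cone_metric mu nu.
Proof.
by apply: le_trans (gap_sup [::] mu nu); rewrite mulr_ge0// exprn_ge0.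
Qed.

Lemma cone_metric_sym mu nu : cone_metric mu nu = cone_metric nu mu.
Proof. by congr sup; apply: eq_imagel => s _; rewrite /gap distrC. Qed.

Lemma cone_metric_triangle mu nu xi :
  cone_metric mu xi <= cone_metric mu nu + cone_metric nu xi.
Proof.
apply: cone_metric_le => s.
apply: le_trans (lerD (gap_sup s mu nu) (gap_sup s nu xi)).
by rewrite -mulrDr ler_wpM2l ?exprn_ge0// ler_distD.
Qed.

(** One list [s] below [f] nearly attains the integral against [mu]; a small gap at [s] carries it
    over to [nu], where [cones s <= f] gives the lower bound. *)
Lemma cone_metric_lsc mu f (e : R) : measurable_fun setT f ->
  (forall u, 0 <= f u <= 1) -> lsc f -> 0 < e ->
  exists2 eta, 0 < eta & forall nu, cone_metric mu nu < eta ->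
    (\int[mu]_u f u)%R - e <= (\int[nu]_u f u)%R.
Proof.
move=> mf f01 lscf e0; have e2 : 0 < e / 2 by rewrite divr_gt0.
have [s sf hs] := cones_Rintegral mu mf f01 lscf e2.
have p0 : 0 < 2^-1 ^+ pickle s :> R by rewrite exprn_gt0.
exists (2^-1 ^+ pickle s * (e / 2)); first exact: mulr_gt0.
move=> nu /(le_lt_trans (gap_sup s mu nu)); rewrite /gap ltr_pM2l// ltr_norml => h.
have : (\int[nu]_u cones s u <= \int[nu]_u f u)%R.
  apply: le_Rintegral => //; apply: unit_integrable => //.
    exact: measurable_cones.
  exact: cones_itv.
lra.
Qed.

(** [cone_metric_lsc] at distance 0 compares the integrals of lower semicontinuous functions in both
    directions; indicators of open boxes are such functions and determine the law. *)
Lemma cone_metric_same mu nu : cone_metric mu nu = 0 -> same_measure mu nu.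
Proof.
move=> h0.
have key mu1 mu2 f : cone_metric mu1 mu2 = 0 -> measurable_fun setT f ->
    (forall u, 0 <= f u <= 1) -> lsc f ->
    (\int[mu1]_u f u <= \int[mu2]_u f u)%R.
  move=> h mf f01 lf; apply/ler_addgt0Pr => e e0.
  have [eta eta0 /(_ mu2)] := cone_metric_lsc mu1 mf f01 lf e0.
  by rewrite h => /(_ eta0); rewrite lerBlDr.
apply: (@same_measure_boxes _ _ _ (@open E)).
- exact: borelE.
- exact: openT.
- by move=> A B; exact: openI.
move=> A oA.
have mA : measurable (box A) by apply: measurable_box => i; exact: open_measurableE.
have f01 u : 0 <= (\1_(box A) u : R) <= 1.
  by rewrite indicE; case: (_ \in _); rewrite ?lexx ler01.
have lscA : lsc \1_(box A).
  move=> t c; rewrite indicE; have [tA|_] := boolP (_ \in _) => ct; last first.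
    exists 1 => // u _; apply: lt_le_trans ct _; by case/andP: (f01 u).
  have : nbhs t (box A).
    apply: open_nbhs_nbhs; split; last exact: set_mem.
    rewrite boxE; apply: (big_ind open) => [|B C oB oC|i _].
    - exact: openT.
    - exact: openI.
    - by apply: open_comp (oA i) => u _; exact: tnth_continuous.
  move=> /nbhs_dist1[e e0 he]; exists e => // u /he uA.
  by rewrite indicE mem_set.
have mI : measurable_fun setT (\1_(box A) : _ -> R) by exact: measurable_indic.
have : fine (mu (box A)) = fine (nu (box A)).
  rewrite -!Rintegral_indic//; apply/eqP; rewrite eq_le !key//.
  by rewrite cone_metric_sym.
by move=> eqA; rewrite -(fineK (prob_fin mu mA)) eqA fineK// prob_fin.
Qed.

Lemma lsc_continuous f : continuous f -> lsc f.
Proof.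
move=> cf t c ct; apply: nbhs_dist1; move/cvgrPdist_lt : (cf t) => /(_ (f t - c)).
rewrite subr_gt0 => /(_ ct); apply: filterS => u /=; rewrite ltr_norml; lra.
Qed.

Lemma cone_metric_nbhs mu (U : set (weak_prob E j)) :
  nbhs (mu : weak_prob E j) U ->
  exists2 e : R, 0 < e & [set nu | cone_metric mu nu < e] `<=` U.
Proof.
pose F : set_system (weak_prob E j) := filter_from [set e : R | 0 < e]
  (fun e => [set nu : weak_prob E j | cone_metric mu nu < e]).
have FF : Filter F.
  apply: filter_from_filter; first by exists 1 => /=.
  move=> e1 e2 /= e10 e20; exists (Num.min e1 e2); first by rewrite /= lt_min e10.
  by move=> u /=; rewrite lt_min => /andP.
suff h : F --> (mu : weak_prob E j) by move=> /h [e e0 he]; exists e.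
apply: cvg_initial_eval => -[f [cf mf [M fM]]].
apply/cvgrPdist_le => e e0 /=.
pose M' := `|M| + 1; have M'0 : 0 < M' by rewrite ltr_pwDr.
have fM' x : `|f x| <= M'.
  by rewrite (le_trans (fM x))// (le_trans (ler_norm _))// lerDl.
(* An affine map from [[-M', M']] onto [0, 1]. The signs [b = 1] and [b = -1] turn the one-sided
   [cone_metric_lsc] into a two-sided bound. *)
pose g (b : R) x := (2 * M')^-1 * (b * f x + M').
have M2 : 0 < 2 * M' by rewrite mulr_gt0.
have gP b : `|b| = 1 -> [/\ measurable_fun setT (g b), continuous (g b) &
    forall x, 0 <= g b x <= 1].
  move=> b1; split.
  - by apply: measurable_funM => //; apply: measurable_funD => //; apply: measurable_funM.
  - move=> x; apply: (@continuousM R _ (cst _) (fun x => b * f x + M')).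
      exact: cst_continuous.
    apply: (@continuousD R R^o _ (fun x => b * f x) (cst _)); last exact: cst_continuous.
    by apply: (@continuousM R _ (cst b) f); [exact: cst_continuous|exact: cf].
  move=> x; have : `|b * f x| <= M' by rewrite normrM b1 mul1r.
  rewrite ler_norml => h; rewrite /g mulrC divr_ge0 ?(ltW M2)//=; last by lra.
  by rewrite ler_pdivrMr//; lra.
have gI b (xi : probability (j.-tuple E) R) : `|b| = 1 ->
    (\int[xi]_x f x)%R * b = 2 * M' * (\int[xi]_x g b x)%R - M'.
  move=> b1; have [mg cg g01] := gP _ b1.
  have intg := unit_integrable xi mg g01.
  have intf := bounded_integrable xi mf fM.
  rewrite -RintegralZl// -RintegralZr// -[X in _ = _ - X](Rintegral_cst_prob xi).
  rewrite -RintegralB//.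
  - by apply: eq_Rintegral => x _; rewrite /g mulVKf ?gt_eqF// addrK mulrC.
  - by have := integrableZl measurableT (2 * M') intg; apply: eq_integrable.
  - exact: (cst_integrable xi M').
have e3 : 0 < e / (2 * M') by rewrite divr_gt0.
have one_sided b : `|b| = 1 -> exists2 eta, 0 < eta &
    forall nu, cone_metric mu nu < eta ->
    (\int[mu]_x f x)%R * b - e <= (\int[nu]_x f x)%R * b.
  move=> b1; have [mg cg g01] := gP _ b1.
  have [eta eta0 h] := cone_metric_lsc mu mg g01 (lsc_continuous cg) e3.
  exists eta => // nu /h; rewrite !gI// -(ler_pM2l M2) mulrBr.
  by rewrite [2 * M' * (e / _)]mulrC divfK ?gt_eqF//; lra.
have [eta1 eta10 h1] := one_sided 1 (normr1 R).
have [eta2 eta20 h2] := one_sided (-1) (normrN1 R).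
exists (Num.min eta1 eta2); first by rewrite /= lt_min eta10.
move=> nu /=; rewrite lt_min => /andP[/h1 + /h2].
by rewrite /integrals/= !(mulr1, mulrN1) ler_norml; lra.
Qed.

Lemma nbhs_cone_metric mu (e : R) : 0 < e ->
  nbhs (mu : weak_prob E j) [set nu : weak_prob E j | cone_metric mu nu < e].
Proof.
move=> e0; have e2 : 0 < e / 2 by rewrite divr_gt0.
(* Lists of index at least [N] have gap at most [2^-N]; the finitely many others are controlled by a
   weak neighbourhood. *)
have [N Ne] : exists N, 2^-1 ^+ N < e / 2.
  by apply: exprn_small => //; lra.
pose P (k : 'I_N) (nu : weak_prob E j) := forall s, pickle s = k ->
  gap s mu nu <= e / 2.
have : \forall nu \near (mu : weak_prob E j), forall k, P k nu.
  apply: (@filter_forall (weak_prob E j) 'I_N P (nbhs (mu : weak_prob E j)) _) => k.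
  have [[s sk]|h] := pselect (exists s : seq cone_code, pickle s = k); last first.
    by apply: nearW => nu s sk; exfalso; apply: h; exists s.
  have tf : [/\ continuous (cones s), measurable_fun setT (cones s) &
      exists M, forall x, `|cones s x| <= M].
    split; [exact: cones_continuous|exact: measurable_cones|exists 1 => x].
    by have /andP[c0 c1] := cones_itv s x; rewrite ger0_norm.
  have := @initial_eval_continuous _ _ _ (@integrals R d E j) (exist _ _ tf) mu.
  move=> /cvgrPdist_le /(_ _ e2); apply: filterS => nu /= h s' s'k.
  have -> : s' = s by apply: (pcan_inj pickleK); rewrite s'k.
  by rewrite /gap (le_trans _ h)// ler_piMl//; case/andP: (half_pow (pickle s)).
apply: filterS => nu h /=; apply: (@le_lt_trans _ _ (e / 2)); last by lra.
apply: cone_metric_le => s; have [sN|Ns] := ltnP (pickle s) N.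
  exact: (h (Ordinal sN)).
rewrite (le_trans (gap_le s mu nu))// (le_trans _ (ltW Ne))//.
by rewrite ler_wiXn2l//; lra.
Qed.

Lemma cone_metric_metrizes : metrizes cone_metric.
Proof.
split.
- move=> mu nu; split; first exact: cone_metric_same.
  move=> h; apply/eqP; rewrite eq_le cone_metric_ge0 andbT.
  have tv0 : tv_le mu nu 0 by apply: tv_le_eq (tv_le_refl mu).
  apply: cone_metric_le => s.
  rewrite (le_trans _ (tv_le_Rintegral (measurable_cones s) (cones_itv s) tv0))//.
  by rewrite ler_piMl//; case/andP: (half_pow (pickle s)).
- exact: cone_metric_sym.
- exact: cone_metric_triangle.
- move=> mu U; split; first exact: cone_metric_nbhs.
  by move=> [e e0 eU]; apply: filterS eU _; exact: nbhs_cone_metric.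
Qed.

End countable_weak_metric.

Lemma separable_weakly_metrizable (R : realType) d (E : borelMetricType R d) :
  separable_space E -> weakly_metrizable E.
Proof.
move=> [D cD dD] j _.
have [f finj] := countable_injP _ cD.
(* A left inverse of the injection [f] on [D]; indices outside [f(D)] get the default [point]. *)
pose a n := xget point [set x | D x /\ f x = n].
have aD x : D x -> a (f x) = x.
  move=> Dx; rewrite /a; case: xgetP => [y _ [Dy fy]|/(_ x)[]//].
  by apply: finj => //; rewrite inE.
exists (@cone_metric R d E j a); apply: cone_metric_metrizes => x e e0.
have : (ball x e)^° `&` D !=set0.
  apply: dD; last exact: open_interior.
  by exists x; exact: nbhsx_ballx.
move=> [y [/interior_subset xy Dy]]; exists (f y); rewrite aD// metric_sym.
by move: xy; rewrite ballEmdist.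
Qed.

(** * The triangular array *)

Section powR_small.
Context (R : realType) (kappa : R).
Hypothesis k01 : 0 < kappa < 1.

Let k0 : 0 <= kappa. Proof. by case/andP: k01 => /ltW. Qed.

Let kn0 : kappa != 0. Proof. by rewrite gt_eqF//; case/andP: k01. Qed.

(** For [t] in [0, 1] one has [t <= t^kappa]; it is applied to [a / (a + b)] and [b / (a + b)],
    whose sum is 1. *)
Lemma powR_subadditive (a b : R) : 0 <= a -> 0 <= b ->
  (a + b) `^ kappa <= a `^ kappa + b `^ kappa.
Proof.
move=> a0 b0; have [ab0|ab0] := leP (a + b) 0.
  have -> : a + b = 0 by lra.
  by rewrite powR0// addr_ge0 ?powR_ge0.
have frac (c : R) : 0 <= c -> c <= a + b ->
    (a + b) `^ kappa * (c / (a + b)) <= c `^ kappa.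
  move=> c0 cab; have q0 : 0 <= c / (a + b) by rewrite divr_ge0// ltW.
  rewrite -[in leRHS](divfK (lt0r_neq0 ab0) c) mulrC powRM ?(ltW ab0)//.
  rewrite ler_wpM2r ?powR_ge0//.
  have [->|cn0] := eqVneq (c / (a + b)) 0; first exact: powR_ge0.
  apply: ger1_powR; last by case/andP: k01 => _ /ltW.
  by rewrite lt_neqAle eq_sym cn0 q0/= ler_pdivrMr// mul1r.
rewrite (le_trans _ (lerD (frac a a0 _) (frac b b0 _))) ?lerDl ?lerDr//.
by rewrite -mulrDr -mulrDl divff ?gt_eqF// mulr1.
Qed.

Lemma powR_small (c e : R) : 0 <= c -> 0 < e ->
  exists2 delta, 0 < delta & forall x, 0 <= x -> x < delta -> c * x `^ kappa <= e.
Proof.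
move=> c0 e0; have t0 : 0 < e / (c + 1) by rewrite divr_gt0// ltr_pwDr.
(* Dividing by [c + 1] rather than [c] allows [c = 0]. *)
exists ((e / (c + 1)) `^ kappa^-1); first exact: powR_gt0.
move=> x x0 xd.
have : x `^ kappa <= e / (c + 1).
  rewrite -[leRHS]powRr1 ?(ltW t0)// -[X in _ <= _ `^ X](mulVf kn0).
  by rewrite powRrM ge0_ler_powR ?nnegrE ?powR_ge0// ltW.
rewrite ler_pdivlMr ?ltr_pwDr// => h; apply: le_trans h.
by rewrite mulrC ler_wpM2l ?powR_ge0// lerDl.
Qed.

End powR_small.

Section clamp0.
Context (R : realType).
Implicit Types x y u : R.

Lemma clamp0_id x : 0 <= x -> clamp0 x = x.
Proof. by move=> x0; apply/max_idPr. Qed.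

Lemma clamp0_itv x : x <= 1 -> 0 <= clamp0 x <= 1.
Proof. by move=> x1; rewrite /clamp0 le_max lexx/= ge_max ler01. Qed.

Lemma clamp0_lipschitz x y : `|clamp0 x - clamp0 y| <= `|x - y|.
Proof.
rewrite /clamp0; case: (leP 0 x) => x0; case: (leP 0 y) => y0.
- by [].
- by rewrite subr0 !ger0_norm; lra.
- by rewrite sub0r normrN distrC !ger0_norm; lra.
- by rewrite subrr normr0.
Qed.

(** Kernels depend on clamped times, so the bounds first involve these; this relaxes them to the
    times [s / n] themselves. *)
Lemma dist_clamp0 u x : 0 <= u -> `|u - clamp0 x| <= `|u - x|.
Proof. by move=> u0; rewrite -{1}(clamp0_id u0) clamp0_lipschitz. Qed.

Lemma time_le1 (n : nat) (s : int) : (0 < n)%N -> s <= n%:Z ->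
  s%:~R / n%:R <= 1 :> R.
Proof. by move=> n0 sn; rewrite ler_pdivrMr ?ltr0n// mul1r -[n%:R]/(n%:~R) ler_int. Qed.

End clamp0.

(** * Bounds for the array and its stationary approximations *)

Section approximation.
Context (R : realType) (m : nat) (r L kappa : R).
Hypotheses (hr : 0 < r < 1) (hL : 0 < L) (hkappa : 0 < kappa < 1).
Context d (E : borelMetricType R d) (Q : R -> R.-pker E ~> E).
Hypotheses
  (A1 : forall (u : R) (x y : E), 0 <= u <= 1 ->
    (tv (mact \d_x (kpow (Q u) m)) (mact \d_y (kpow (Q u) m)) <= r%:E)%E)
  (A2 : forall (u v : R) (x : E), 0 <= u <= 1 -> 0 <= v <= 1 ->
    (tv (mact \d_x (fun z => Q u z)) (mact \d_x (fun z => Q v z)) <=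
     (L * `|u - v| `^ kappa)%:E)%E).

Let C := tv_const m r L (m%:R `^ kappa).

Lemma kernel_tv u v x : 0 <= u <= 1 -> 0 <= v <= 1 ->
  tv_le (Q u x) (Q v x) (L * `|v - u| `^ kappa).
Proof.
move=> u01 v01; rewrite distrC.
have mactE w A : measurable A -> mact \d_x (fun z => Q w z) A = Q w x A.
  move=> mA; rewrite /mact integral_dirac//; last exact: measurable_kernel.
  by rewrite diracT mul1e.
have fin w A : measurable A -> mact \d_x (fun z => Q w z) A \is a fin_num.
  by move=> mA; rewrite mactE// kernel_fin.
have /(tv_leP _ (fin u) (fin v)) h := A2 x u01 v01.
by move=> A mA; rewrite -!mactE//; exact: h.
Qed.

Section array.
Context (n : nat) dX (OX : measurableType dX) (PX : probability OX R)
  (X : int -> {RV PX >-> E}).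
Hypotheses (n0 : (0 < n)%N)
  (hX : markov_chain [set k : int | k <= n%:Z]
          (fun k => Q (clamp0 (k%:~R / n%:R))) X).
Context (u : R) dY (OY : measurableType dY) (PY : probability OY R)
  (Y : int -> {RV PY >-> E}).
Hypotheses (u01 : 0 <= u <= 1)
  (hY : markov_chain [set: int] (fun=> Q u) Y) (sY : stationary Y).

Lemma array_tv j k : k + j%:Z <= n%:Z ->
  tv_le (law X k j.+1) (law Y 1 j.+1)
    (C * (\sum_(i < j.+1) `|u - clamp0 ((k + i%:Z)%:~R / n%:R)| `^ kappa +
          1 / n%:R `^ kappa)).
Proof.
move=> kjn; have nR : 0 < n%:R :> R by rewrite ltr0n.
have k0 : 0 <= kappa by case/andP: hkappa => /ltW.
(* Stationarity moves the block of [Y] from time 1 to time [k], so that both chains run on the same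
   clock. *)
apply: (@tv_le_eq _ _ _ (law X k j.+1) _ (law Y k j.+1)); [by []|exact: sY|].
apply: (@tv_le_coupling _ _ _ _ _ _ _ _ _ _ _ n%:Z
  (fun k => Q (clamp0 (k%:~R / n%:R))) (Q u) hX hY m r L
  (m%:R `^ kappa) (1 / n%:R `^ kappa)
  (fun s : int => `|u - clamp0 (s%:~R / n%:R)| `^ kappa)) => //.
- by case/andP: hr.
- exact: ltW.
- by move=> x y; exact: A1.
- move=> s x sn; apply: kernel_tv => //.
  by apply: clamp0_itv; exact: time_le1.
(* The condition [slow_e]: rescaled times at most [m] steps apart differ by at most [m / n], and
   subadditivity of the power splits off [(m / n)^kappa = m^kappa * n^-kappa]. *)
move=> k' s kn' /andP[ks sk].
have h1 : `|u - clamp0 (s%:~R / n%:R)| <=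
    `|u - clamp0 (k'%:~R / n%:R)| + m%:R / n%:R.
  rewrite (le_trans (ler_distD (clamp0 (k'%:~R / n%:R)) _ _))// lerD2l.
  rewrite (le_trans (clamp0_lipschitz _ _))// -mulrBl normrM (ger0_norm (x := n%:R^-1))//.
  rewrite ler_wpM2r// -intrB ger0_norm; last by rewrite ler0z subr_ge0.
  by rewrite -[m%:R]/(m%:~R) ler_int lerBlDr -lerBlDl.
apply: le_trans (ge0_ler_powR k0 _ _ h1) _; rewrite ?nnegrE//.
apply: le_trans (powR_subadditive hkappa _ _) _; rewrite ?divr_ge0//.
have -> : m%:R `^ kappa = (m%:R / n%:R) `^ kappa * n%:R `^ kappa.
  by rewrite -powRM ?divr_ge0// divfK// lt0r_neq0.
by rewrite lerD2l mul1r mulfK// gt_eqF// powR_gt0.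
Qed.

End array.

(** The chain with kernel [Q u] plays the role of an array with constant kernel: the coupling bound
    with constant [e] and [w = 0]. *)
Lemma stationary_tv (u v : R)
  dY (OY : measurableType dY) (PY : probability OY R) (Y : int -> {RV PY >-> E})
  dZ (OZ : measurableType dZ) (PZ : probability OZ R) (Z : int -> {RV PZ >-> E}) j :
  0 <= u <= 1 -> 0 <= v <= 1 ->
  markov_chain [set: int] (fun=> Q u) Y -> markov_chain [set: int] (fun=> Q v) Z ->
  tv_le (law Y 1 j.+1) (law Z 1 j.+1) (C * j.+1%:R * `|u - v| `^ kappa).
Proof.
move=> u01 v01 hY hZ.
apply: (@tv_le_weaken _ _ _ _ _ (C * (\sum_(i < j.+1) `|u - v| `^ kappa + 0))).
  by rewrite sumr_const card_ord addr0 -[_ *+ j.+1]mulr_natl mulrA.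
apply: (@tv_le_coupling _ _ _ _ _ _ _ _ _ _ _ (1 + j%:Z) (fun=> Q u) (Q v)
  _ hZ m r L (m%:R `^ kappa) 0 (fun=> `|u - v| `^ kappa)) => //.
- by move=> k _; exact: hY.
- by case/andP: hr.
- exact: ltW.
- by move=> x y; exact: A1.
- by move=> s x _; rewrite distrC; exact: kernel_tv.
- by move=> k s _ _; rewrite mulr0 addr0.
Qed.

Section local_stationarity.
Context (dX : nat -> measure_display) (OX : forall n, measurableType (dX n))
  (PX : forall n, probability (OX n) R) (X : forall n : nat, int -> {RV (PX n) >-> E}).
Hypothesis hX : forall n : nat, (1 <= n)%N ->
  markov_chain [set k : int | k <= n%:Z]
    (fun k => Q (clamp0 (k%:~R / n%:R))) (X n).
Context (dY : R -> measure_display) (OY : forall u, measurableType (dY u))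
  (PY : forall u, probability (OY u) R) (Y : forall u : R, int -> {RV (PY u) >-> E}).
Hypothesis hY : forall u : R, 0 <= u <= 1 ->
  markov_chain [set: int] (fun=> Q u) (Y u) /\ stationary (Y u).

Let C0 : 0 < C.
Proof. by apply: tv_const_gt0 => //; case/andP: hr. Qed.

Lemma stationary_tv_small j (e : R) : 0 < e ->
  exists2 delta, 0 < delta & forall u v, 0 <= u <= 1 -> 0 <= v <= 1 ->
    `|u - v| < delta -> tv_le (law (Y u) 1 j.+1) (law (Y v) 1 j.+1) e.
Proof.
move=> e0; have C1 : 0 <= C * j.+1%:R by rewrite mulr_ge0// ltW.
have [delta delta0 h] := powR_small hkappa C1 e0.
exists delta => // u v u01 v01 uv; apply: tv_le_weaken (h _ (normr_ge0 _) uv) _.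
by apply: stationary_tv => //; [exact: (hY u01).1|exact: (hY v01).1].
Qed.

(** With [u] the clamped time [k / n], all times of the block are within [j / n] of [u], and
    [array_tv] gives [c * n^-kappa] with [c] independent of [k]. *)
Lemma array_tv_small j (e : R) : 0 < e ->
  \forall n \near \oo, forall k : int, k + j%:Z <= n%:Z ->
    tv_le (law (X n) k j.+1) (law (Y (clamp0 (k%:~R / n%:R))) 1 j.+1) e.
Proof.
move=> e0; have k0 : 0 <= kappa by case/andP: hkappa => /ltW.
pose c := C * (j.+1%:R * j%:R `^ kappa + 1).
have c0 : 0 <= c by rewrite mulr_ge0 ?ltW// ltr_wpDl// mulr_ge0// powR_ge0.
have [delta delta0 h] := powR_small hkappa c0 e0.
exists (Num.truncn delta^-1).+1 => // n /= nd k kjn.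
have n0 : (0 < n)%N by exact: leq_ltn_trans nd.
have nR : 0 < n%:R :> R by rewrite ltr0n.
have kn : k <= n%:Z by rewrite (le_trans _ kjn)// lerDl.
have v01 : 0 <= (clamp0 (k%:~R / n%:R) : R) <= 1 by apply: clamp0_itv; exact: time_le1.
have [mY sY] := hY v01.
have := array_tv n0 (hX n0) v01 mY sY kjn; apply: tv_le_weaken.
have nV : n%:R^-1 < delta.
  rewrite -[delta]invrK ltf_pV2 ?posrE ?invr_gt0//.
  by rewrite -truncn_lt_nat// invr_ge0 ltW.
have := h _ _ nV; rewrite invr_ge0 ltW// => /(_ isT); apply: le_trans.
have nVE : n%:R^-1 `^ kappa = 1 / n%:R `^ kappa.
  rewrite -[LHS](mulfK (lt0r_neq0 (powR_gt0 kappa nR))) -powRM ?invr_ge0//.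
  by rewrite mulVf ?gt_eqF// powR1.
rewrite /c -mulrA ler_pM2l// -nVE mulrDl mul1r lerD2r.
rewrite -mulrA -powRM ?invr_ge0//.
rewrite [leRHS](_ : _ = \sum_(i < j.+1) (j%:R / n%:R) `^ kappa); last first.
  by rewrite sumr_const card_ord mulr_natl.
apply: ler_sum => i _.
apply: ge0_ler_powR => //; rewrite ?nnegrE ?divr_ge0//.
rewrite (le_trans (clamp0_lipschitz _ _))// -mulrBl intrD opprD addrA subrr sub0r.
rewrite mulNr normrN ger0_norm ?divr_ge0// ler_wpM2r// ler_nat.
by rewrite -ltnS ltn_ord.
Qed.

Lemma locally_stationary_array : weakly_metrizable E ->
  locally_stationary (fun n => law (X n)) (fun u => law (Y u) 1).
Proof.
move=> wE [//|j] _; have [theta theta_metr] := wE j.+1 isT.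
have [theta_eq theta_sym theta_tri theta_nbhs] := theta_metr.
have theta_ge0 mu nu : 0 <= theta mu nu.
  have := theta_tri mu nu mu; rewrite (theta_sym nu mu).
  have -> : theta mu mu = 0 by apply/theta_eq.
  by lra.
exists theta; split => //.
  apply/subspace_continuousP => u; rewrite /= in_itv/= => u01 U.
  move=> /nbhs_weak_tv[e e0 eU].
  have [delta delta0 h] := stationary_tv_small j e0.
  change (nbhs u [set v | `[0, 1]%classic v -> U (law (Y v) 1 j.+1)]).
  apply: filterS (nbhsx_ballx u delta delta0) => v /= uv; rewrite in_itv/= => v01.
  by apply: eU; apply: h => //; rewrite distrC.
have near0 (e : R) : 0 < e -> \forall n \near \oo, forall k : int,
    k <= n%:Z - j.+1%:Z + 1 ->
    theta (law (X n) k j.+1) (law (Y (clamp0 (k%:~R / n%:R))) 1 j.+1) <= e.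
  move=> e0.
  (* The total variation radius that fits into a [theta] ball depends on its centre, so uniformity
     in [k] comes from a covering of [0, 1]; [v] stands for the clamped time. *)
  have cover := (compact_near_coveringP _).1 (segment_compact (a := 0 : R) (b := 1)).
  have := cover _ (\oo) (fun (n : nat) (v : R) => forall k : int,
    k <= n%:Z - j.+1%:Z + 1 -> clamp0 (k%:~R / n%:R) = v ->
    theta (law (X n) k j.+1) (law (Y v) 1 j.+1) <= e) _.
  have kj (k : int) (n : nat) : k <= n%:Z - j.+1%:Z + 1 -> k + j%:Z <= n%:Z by lia.
  have clamp_itv (k : int) (n : nat) : (0 < n)%N -> k + j%:Z <= n%:Z ->
      0 <= (clamp0 (k%:~R / n%:R) : R) <= 1.
    by move=> n0 kn; apply/clamp0_itv/time_le1 => //; rewrite (le_trans _ kn)// lerDl.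
  have local (u : R) : `[0, 1]%classic u -> \forall v \near u & n \near \oo,
      forall k : int, k <= n%:Z - j.+1%:Z + 1 -> clamp0 (k%:~R / n%:R) = v ->
      theta (law (X n) k j.+1) (law (Y v) 1 j.+1) <= e.
    rewrite /= in_itv/= => u01.
    have e2 : 0 < e / 2 by rewrite divr_gt0.
    have : nbhs (law (Y u) 1 j.+1 : weak_prob E j.+1)
        [set nu | theta (law (Y u) 1 j.+1) nu < e / 2].
      by apply/theta_nbhs; exists (e / 2).
    move=> /nbhs_weak_tv[eta eta0 hU].
    have eta2 : 0 < eta / 2 by rewrite divr_gt0.
    have [delta delta0 hdelta] := stationary_tv_small j eta2.
    exists (ball u delta, [set n | (0 < n)%N /\ forall k : int, k + j%:Z <= n%:Z ->
      tv_le (law (X n) k j.+1) (law (Y (clamp0 (k%:~R / n%:R))) 1 j.+1) (eta / 2)]).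
      split; first exact: nbhsx_ballx.
      by apply: filterI; [exists 1%N|exact: array_tv_small].
    move=> [v n] /= [uv [n0 hn]] k /kj kn kv.
    have v01 : 0 <= v <= 1 by rewrite -kv clamp_itv.
    (* Both laws are compared with the one at the centre [u]: each lies within [eta] in total
       variation, hence within [e / 2] for [theta]. *)
    have Yvu : tv_le (law (Y v) 1 j.+1) (law (Y u) 1 j.+1) (eta / 2).
      by apply: hdelta => //; rewrite distrC.
    have Xu : tv_le (law (X n) k j.+1) (law (Y u) 1 j.+1) eta.
      have := hn _ kn; rewrite kv => /tv_le_trans /(_ Yvu).
      by apply: tv_le_weaken; lra.
    have hY1 : theta (law (Y u) 1 j.+1) (law (Y v) 1 j.+1) < e / 2.
      by apply: hU; apply: tv_le_weaken Yvu; lra.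
    have hX1 : theta (law (Y u) 1 j.+1) (law (X n) k j.+1) < e / 2 by exact: hU.
    rewrite theta_sym in hX1.
    by have := theta_tri (law (X n) k j.+1) (law (Y u) 1 j.+1) (law (Y v) 1 j.+1); lra.
  move=> /(_ eventually_filter local) cov.
  near=> n => k kn; have n0 : (0 < n)%N by near: n; exists 1%N.
  have : `[0, 1]%classic (clamp0 (k%:~R / n%:R) : R).
    by rewrite /= in_itv/= clamp_itv// kj.
  move=> /(near cov n _); apply => //.
have sup_itv n (e : R) : (forall k : int, k <= n%:Z - j.+1%:Z + 1 ->
    theta (law (X n) k j.+1) (law (Y (clamp0 (k%:~R / n%:R))) 1 j.+1) <= e) ->
    (0 <= ereal_sup [set (theta (law (X n) k j.+1)
        (law (Y (clamp0 (k%:~R / n%:R))) 1 j.+1))%:E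
      | k in [set k : int | (k <= n%:Z - j.+1%:Z + 1)%R]] <= e%:E)%E.
  move=> h; apply/andP; split; last first.
    by apply: ge_ereal_sup => _ [k /= kn <-]; rewrite lee_fin h.
  (* The index set contains its largest element [n - j], so the supremum is not [-oo] and is bounded
     below by a nonnegative term. *)
  apply: (@le_trans _ _ (theta (law (X n) (n%:Z - j.+1%:Z + 1) j.+1)
    (law (Y (clamp0 ((n%:Z - j.+1%:Z + 1)%:~R / n%:R))) 1 j.+1))%:E).
    by rewrite lee_fin.
  by apply: ereal_sup_ubound; exists (n%:Z - j.+1%:Z + 1) => /=.
apply/fine_cvgP; split.
  have := near0 1 ltr01; apply: filterS => n /sup_itv /andP[s0 s1].
  by rewrite ge0_fin_numE// (le_lt_trans s1)// ltry.
apply/cvgrPdist_le => e e0; have := near0 e e0; apply: filterS => n /sup_itv /andP[s0 s1].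
rewrite sub0r normrN ger0_norm ?fine_ge0//= -lee_fin fineK//.
by rewrite ge0_fin_numE// (le_lt_trans s1)// ltry.
Unshelve. all: by end_near. Qed.

End local_stationarity.
End approximation.

Theorem theorem1 (R : realType) (m : nat) (r L kappa : R)
  (hm : (1 <= m)%N) (hr : 0 < r < 1) (hL : 0 < L) (hkappa : 0 < kappa < 1) :
  exists2 C : R, 0 < C &
  forall (d : measure_display) (E : borelMetricType R d)
    (Q : R -> R.-pker E ~> E)
    (A1 : forall (u : R) (x y : E), 0 <= u <= 1 ->
       (tv (mact \d_x (kpow (Q u) m)) (mact \d_y (kpow (Q u) m)) <= r%:E)%E)
    (A2 : forall (u v : R) (x : E), 0 <= u <= 1 -> 0 <= v <= 1 ->
       (tv (mact \d_x (fun z => Q u z)) (mact \d_x (fun z => Q v z)) <=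
        (L * `|u - v| `^ kappa)%:E)%E),
  (forall u : R, 0 <= u <= 1 ->
     exists2 pi_u : probability E R, invariant_measure (Q u) pi_u &
       forall nu : probability E R,
         invariant_measure (Q u) nu -> same_measure nu pi_u)
  /\
  (forall
     (dX : nat -> measure_display) (OX : forall n, measurableType (dX n))
     (PX : forall n, probability (OX n) R)
     (X : forall n : nat, int -> {RV (PX n) >-> E})
     (hX : forall n : nat, (1 <= n)%N ->
        markov_chain [set k : int | k <= n%:Z]
          (fun k => Q (clamp0 (k%:~R / n%:R))) (X n))
     (dY : R -> measure_display) (OY : forall u, measurableType (dY u))
     (PY : forall u, probability (OY u) R)
     (Y : forall u : R, int -> {RV (PY u) >-> E})
     (hY : forall u : R, 0 <= u <= 1 ->
        markov_chain [set: int] (fun=> Q u) (Y u) /\ stationary (Y u)),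
   (separable_space E \/ weakly_metrizable E ->
    locally_stationary (fun n => law (X n)) (fun u => law (Y u) 1))
   /\
   (forall (u : R) (n j : nat) (k : int),
      0 <= u <= 1 -> (1 <= n)%N -> (1 <= j)%N -> k + j%:Z - 1 <= n%:Z ->
      (tv (law (X n) k j) (law (Y u) 1 j) <=
       (C * ((\sum_(i < j) `|u - (k + i%:Z)%:~R / n%:R| `^ kappa)
             + 1 / n%:R `^ kappa))%:E)%E)).
Proof.
(* Chosen before [E], [Q] and the chains; the last argument [m^kappa] comes from [(m / n)^kappa] in
   [array_tv]. *)
exists (tv_const m r L (m%:R `^ kappa)).
  by apply: tv_const_gt0 => //; case/andP: hr.
move=> d E Q A1 A2; split.
  move=> u u01; apply: (@invariant_probability _ _ _ (Q u) m r).
    by case/andP: hr.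
  by move=> x y; exact: A1.
move=> dX OX PX X hX dY OY PY Y hY; split.
  move=> wE; apply: (locally_stationary_array hr hL hkappa A1 A2 hX hY).
  by case: wE => // /separable_weakly_metrizable.
move=> u n [//|j] k u01 n0 _ kjn; have [mY sY] := hY u u01.
have kjn' : k + j%:Z <= n%:Z by lia.
apply/tv_le_prob.
apply: tv_le_weaken (array_tv hr hL hkappa A1 A2 n0 (hX n n0) u01 mY sY kjn').
have C0 : 0 < tv_const m r L (m%:R `^ kappa).
  by apply: tv_const_gt0 => //; case/andP: hr.
rewrite ler_pM2l// lerD2r; apply: ler_sum => i _.
case/andP: u01 => u0 _; case/andP: hkappa => /ltW k0 _.
by apply: ge0_ler_powR; rewrite ?nnegrE// dist_clamp0.
Qed.
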